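(* Let $M$ be a Riemannian manifold, let $\mu$ be a Borel probability measure on $M$ and $\nu$ a positive Borel measure on $M$. Let $q\in[1/2,1)$ and assume that $(\mu,\nu)$ satisfies a weak Poincaré inequality with function $\beta_{WP}$. If $\int_0^{1/2}\beta_{WP}(t/4)^{q/(1-q)}dt<\infty$, then $(\mu,\nu)$ satisfies an $L^q$-Poincaré inequality, with $$\beta_P\le\kappa_P\Big(\frac{4}{1-q}\Big)^{\frac{1-q}{q}}\Big(\int_0^{1/2}\beta_{WP}(t/4)^{\frac{q}{1-q}}\,dt\Big)^{\frac{1-q}{q}},$$ where $$\kappa_P:=2^{(1-q)/q}\inf_{\rho\in(0,1)}\frac{(1-\rho^{2q})^{1/q}}{\rho^2(1-\rho)^2}.$$
   Context: $(\mu,\nu)$ satisfies a weak Poincaré inequality with function $\beta_{WP}$ (non-negative, non-increasing on $(0,\infty)$) if for all bounded $f\in C^1(M)$ and all $s>0$: $\mathrm{Var}_\mu(f)\le\beta_{WP}(s)\int|\nabla f|^2d\nu+s[\mathrm{Osc}_\mu(f)]^2$, where $\mathrm{Osc}_\mu(f):=\operatorname{ess\,sup}_\mu f-\operatorname{ess\,inf}_\mu f$. $(\mu,\nu)$ satisfies an $L^q$-Poincaré inequality if for some constant $C_P$ and all non-negative $f\in C^1(M)$: $[\mathrm{Var}_\mu(f^q)]^{1/q}=[\int f^{2q}d\mu-(\int f^qd\mu)^2]^{1/q}\le C_P\int|\nabla f|^2d\nu$. For measurable $A\subset\Omega\subset M$, $\mathrm{Cap}_\nu(A,\Omega):=\inf\{\int|\nabla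 f|^2d\nu: f\in C^1(M),\ \mathbb 1_A\le f\le\mathbb 1_\Omega\}$ ($+\infty$ if there is no such $f$). The constant $\beta_P$ is $$\beta_P:=\sup\Big\{\sum_{k\in\mathbb Z}\frac{[\mu(\Omega_k)]^{1/(1-q)}}{[\mathrm{Cap}_\nu(\Omega_k,\Omega_{k+1})]^{q/(1-q)}}\Big\}^{(1-q)/q},$$ the supremum being over all measurable $\Omega\subset M$ with $\mu(\Omega)\le1/2$ and all sequences of measurable sets with $\Omega_k\subset\Omega_{k+1}\subset\Omega$ for all $k\in\mathbb Z$. (Terms with infinite capacity are $0$, terms with $\mu(\Omega_k)>0$ and zero capacity are $+\infty$, and $0/0$ is read as $0$.) *)

(* Defs.v *)
From HB Require Import structures.
From mathcomp Require Import all_boot all_order all_algebra.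
From mathcomp Require Import all_classical all_reals all_analysis ess_sup_inf.

Set Implicit Arguments.
Unset Strict Implicit.
Unset Printing Implicit Defensive.

Import Order.TTheory GRing.Theory Num.Theory numFieldNormedType.Exports.

Local Open Scope classical_set_scope.
Local Open Scope ring_scope.

(* Only meant for an open set U, so that differentiability and directional
   derivatives at the points of U depend on the values of h on U alone. In
   finite dimension, continuity of the differential amounts to continuity of
   'D_v h for every fixed v. *)
Fixpoint Ck_on (R : realType) (n : nat) (V : normedModType R) (k : nat)
    (U : set 'rV[R]_n) (h : 'rV[R]_n -> V) : Prop :=
  if k is k'.+1 then
    (forall u, U u -> differentiable h u) /\
    (forall v : 'rV[R]_n, Ck_on k' U ('D_v h))
  else forall u, U u -> {for u, continuous h}.

Definition smooth_on (R : realType) (n : nat) (V : normedModType R)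
    (U : set 'rV[R]_n) (h : 'rV[R]_n -> V) : Prop :=
  forall k, Ck_on k U h.

(* A chart i is the homeomorphism chart_map i from the open set chart_dom i onto
   the open set chart_map i @` chart_dom i, with inverse chart_inv i; the values of
   chart_map i and chart_inv i outside these two sets are irrelevant. *)
Record smoothManifold (R : realType) (n : nat) := SmoothManifold {
  carrier :> ptopologicalType;
  manifold_hausdorff : hausdorff_space carrier;
  manifold_second_countable : @second_countable carrier;
  chart : Type;
  chart_dom : chart -> set carrier;
  chart_map : chart -> carrier -> 'rV[R]_n;
  chart_inv : chart -> 'rV[R]_n -> carrier;
  chart_cover : forall x : carrier, exists i, chart_dom i x;
  chart_dom_open : forall i, open (chart_dom i);
  chart_im_open : forall i, open (chart_map i @` chart_dom i);
  chart_mapK : forall i x, chart_dom i x -> chart_inv i (chart_map i x) = x;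
  chart_map_continuous : forall i x, chart_dom i x ->
    {for x, continuous (chart_map i)};
  chart_inv_continuous : forall i u, (chart_map i @` chart_dom i) u ->
    {for u, continuous (chart_inv i)};
  transition_smooth : forall i j,
    smooth_on (chart_map i @` (chart_dom i `&` chart_dom j)) (chart_map j \o chart_inv i)
}.

Definition chart_im (R : realType) (n : nat) (M : smoothManifold R n)
    (i : chart M) : set 'rV[R]_n :=
  @chart_map R n M i @` @chart_dom R n M i.

(* metric i u is the Gram matrix, in the coordinate frame of the chart i, of
   the inner product on the tangent space at chart_inv i u. Vectors are rows, so
   that a vector v in the chart i becomes v *m J in the chart j. *)
Record riemannianManifold (R : realType) (n : nat) := RiemannianManifold {
  base_manifold :> smoothManifold R n;
  metric : chart base_manifold -> 'rV[R]_n -> 'M[R]_n;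
  metric_smooth : forall i, smooth_on (chart_im i) (metric i);
  metric_sym : forall i u, chart_im i u -> (metric i u)^T = metric i u;
  metric_posdef : forall i u, chart_im i u ->
    forall v : 'rV[R]_n, v != 0 -> 0 < (v *m metric i u *m v^T) 0 0;
  metric_change : forall i j x, chart_dom i x -> chart_dom j x ->
    let J := 'J (chart_map j \o chart_inv i) (chart_map i x) in
    metric i (chart_map i x) = J *m metric j (chart_map j x) *m J^T
}.

Definition C1 (R : realType) (n : nat) (M : riemannianManifold R n)
    (f : M -> R) : Prop :=
  forall i : chart M, @Ck_on R n R^o 1 (chart_im i) (f \o chart_inv i).

Definition chart_at (R : realType) (n : nat) (M : riemannianManifold R n)
    (x : M) : chart M :=
  sval (cid (chart_cover x)).

Definition metric_at (R : realType) (n : nat) (M : riemannianManifold R n)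
    (x : M) : 'M[R]_n :=
  metric (chart_at x) (chart_map (chart_at x) x).

Definition differential (R : realType) (n : nat) (M : riemannianManifold R n)
    (f : M -> R) (x : M) : 'rV[R]_n :=
  \row_(j < n) ('D_(delta_mx 0 j : 'rV[R]_n)
    (f \o chart_inv (chart_at x) : _ -> R^o) (chart_map (chart_at x) x)).

(* Coordinates, in the chart chart_at x, of the vector G with
   g(G, v) = df(v) for all v. *)
Definition gradient (R : realType) (n : nat) (M : riemannianManifold R n)
    (f : M -> R) (x : M) : 'rV[R]_n :=
  differential f x *m invmx (metric_at x).

Definition sqnorm_gradient (R : realType) (n : nat)
    (M : riemannianManifold R n) (f : M -> R) (x : M) : R :=
  (gradient f x *m metric_at x *m (gradient f x)^T) 0 0.

Notation borel M := (g_sigma_algebraType (@open M)).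

Local Open Scope ereal_scope.

Definition energy (R : realType) (n : nat) (M : riemannianManifold R n)
    (nu : {measure set (borel M) -> \bar R}) (f : M -> R) : \bar R :=
  \int[nu]_x (sqnorm_gradient f x)%:E.

Definition Osc (R : realType) (n : nat) (M : riemannianManifold R n)
    (mu : probability (borel M) R) (f : M -> R) : \bar R :=
  ess_sup mu (EFin \o f) - ess_inf mu (EFin \o f).

(* As everywhere in measure theory, 0 * +oo = 0. *)
Definition weak_poincare (R : realType) (n : nat) (M : riemannianManifold R n)
    (mu : probability (borel M) R) (nu : {measure set (borel M) -> \bar R})
    (beta : R -> R) : Prop :=
  [/\ forall s : R, (0 < s)%R -> (0 <= beta s)%R,
      forall s t : R, (0 < s)%R -> (s <= t)%R -> (beta t <= beta s)%R &
      forall (f : M -> R) (s : R), C1 f -> bounded_fun f -> (0 < s)%R ->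
        'V_mu[f] <= (beta s)%:E * energy nu f + s%:E * Osc mu f ^+ 2].

(* 'V_mu[X] is +oo for every X >= 0 that is not square-integrable. *)
Definition Lq_poincare (R : realType) (n : nat) (M : riemannianManifold R n)
    (mu : probability (borel M) R) (nu : {measure set (borel M) -> \bar R})
    (q : R) : Prop :=
  exists2 C : R, (0 <= C)%R &
    forall f : M -> R, C1 f -> (forall x, (0 <= f x)%R) ->
      'V_mu[(fun x => f x `^ q)%R] `^ q^-1 <= C%:E * energy nu f.

Definition capacity (R : realType) (n : nat) (M : riemannianManifold R n)
    (nu : {measure set (borel M) -> \bar R}) (A Omega : set M) : \bar R :=
  ereal_inf [set energy nu f | f in [set f : M -> R |
    C1 f /\ forall x, (\1_A x <= f x <= \1_Omega x)%R]].

(* With 0^-1 = +oo, +oo^-1 = 0 and 0 * +oo = 0 in \bar R, a term with infinite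
   capacity is 0, a term with zero capacity is +oo or 0 according to whether
   mu (Omega_ k) > 0 or mu (Omega_ k) = 0. *)
Definition beta_P (R : realType) (n : nat) (M : riemannianManifold R n)
    (mu : probability (borel M) R) (nu : {measure set (borel M) -> \bar R})
    (q : R) : \bar R :=
  ereal_sup [set b : \bar R |
    exists (Omega : set (borel M)) (Omega_ : int -> set (borel M)),
    [/\ measurable Omega, mu Omega <= (2^-1)%:E,
        forall k, measurable (Omega_ k),
        forall k, Omega_ k `<=` Omega_ (k + 1)%R /\
                  Omega_ (k + 1)%R `<=` Omega &
        b = (\esum_(k in [set: int])
               (mu (Omega_ k) `^ (1 - q)^-1 /
                capacity nu (Omega_ k) (Omega_ (k + 1)%R) `^ (q / (1 - q))))
            `^ ((1 - q) / q)]].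

Definition kappa_P (R : realType) (q : R) : R :=
  (2 `^ ((1 - q) / q) *
   inf [set (1 - rho `^ (2 * q)) `^ q^-1 / (rho ^+ 2 * (1 - rho) ^+ 2)
       | rho in [set rho | 0 < rho < 1]])%R.

(* Main.v *)
Require Import Defs.
From HB Require Import structures.
From mathcomp Require Import all_boot all_order all_algebra.
From mathcomp Require Import all_classical all_reals all_analysis ess_sup_inf.
From mathcomp Require Import measurable_realfun.
From mathcomp Require Import ring lra zify.

Set Implicit Arguments.
Unset Strict Implicit.
Unset Printing Implicit Defensive.

Import Order.TTheory GRing.Theory Num.Theory numFieldNormedType.Exports.

Local Open Scope classical_set_scope.
Local Open Scope ring_scope.
Local Open Scope ereal_scope.

(* Let a = mu A, A `<=` Omega and mu Omega <= 1/2. For 1_A <= f <= 1_Omega,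
   Cauchy-Schwarz gives Var f >= a/2, so the weak Poincare inequality at s = a/4
   yields a/4 <= beta(a/4) E(f), i.e. a / Cap(A, Omega) <= 4 beta(a/4).

   Bound on beta_P, with p = q/(1-q) >= 1. Capacities in series satisfy
   1/Cap(A, B) + 1/Cap(B, C) <= 1/Cap(A, C). Hence with a_k = mu Omega_k,
   c_k = 1/Cap(Omega_k, Omega_(k+1)) and D_k the sum of the c_j over j >= k,
   a_k D_k <= 4 beta(a_k/4). Since c_k^p <= D_k^p - D_(k+1)^p, Abel summation bounds
   the sum of the a_k^(1+p) c_k^p by that of the (a_k^(1+p) - a_(k-1)^(1+p)) D_k^p,
   which is at most (1+p) 4^p times the integral of beta(t/4)^p. The remaining
   factor is absorbed by kappa_P, since 4 <= kappa_P 4^(1/p).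

   L^q-Poincare inequality. Let h = f - m or m - f with m a median of f, and let
   a_j = mu(h >= delta 2^j). Smooth truncations of h between consecutive levels give
   (delta 2^j)^2 a_j <= 64 beta(a_j/4) e_j, where e_j is the energy of h between
   these levels, and x^q y^(1-q) <= x + y turns this into a bound of the sum of the
   (delta 2^(j+1))^(2q) (a_j - a_(j+1)), hence of the integral of max(h, 0)^(2q), by
   a constant times E(f)^q. *)

(** * Additivity and scaling of the lower integral *)

(* The measurability of [sqnorm_gradient f], which is defined through an arbitrary
   choice of charts, is never needed: for a nonnegative function the integral of
   the library is a supremum over the simple functions below it, and this lower
   integral is already additive over disjoint measurable domains. *)
Section lower_integral.
Context d (T : measurableType d) (R : realType).
Variable mu : {measure set T -> \bar R}.
Implicit Types (A B D : set T) (f g : T -> \bar R).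

Import HBNNSimple.

Lemma ge0_integral_le D f g : (forall x, D x -> 0 <= f x) ->
  (forall x, D x -> f x <= g x) ->
  \int[mu]_(x in D) f x <= \int[mu]_(x in D) g x.
Proof.
move=> f0 fg.
have g0 x : D x -> 0 <= g x by move=> Dx; exact: le_trans (f0 _ Dx) (fg _ Dx).
rewrite !ge0_integralE// ge_ereal_sup// => _ [h hf <-].
apply: ereal_sup_ubound; exists h => //= x.
apply: (le_trans (hf x)); rewrite /patch; case: ifPn => //.
by rewrite inE => /fg.
Qed.

(** A simple function below [f] on the union is the sum of its restrictions to the two pieces;
    conversely, simple functions below [f] on each piece add up to one below [f] on the union. *)
Lemma ge0_integral_disjointU A B f : measurable A -> measurable B ->
  [disjoint A & B] -> (forall x, 0 <= f x) ->
  \int[mu]_(x in A `|` B) f x = \int[mu]_(x in A) f x + \int[mu]_(x in B) f x.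
Proof.
move=> mA mB /disj_setPS AB f0.
rewrite !ge0_integralE//.
apply/eqP; rewrite eq_le; apply/andP; split.
  apply: ge_ereal_sup => _ [h hf <-].
  have hE : h =1 add_nnsfun (proj_nnsfun h mA) (proj_nnsfun h mB).
    move=> x; rewrite /= !mindicE.
    have := hf x; rewrite /patch in_setU.
    case: (boolP (x \in A)) => xA; case: (boolP (x \in B)) => xB /=.
    - by move: xA xB; rewrite !inE => xA xB; case: (AB x); split.
    - by rewrite mulr1 mulr0 addr0.
    - by rewrite mulr1 mulr0 add0r.
    - move=> hx; rewrite !mulr0 addr0; apply/eqP.
      by rewrite eq_le fun_ge0 -lee_fin hx.
  rewrite (eq_sintegral _ _ hE) sintegralD//.
  have proj_le C (mC : measurable C) : C `<=` A `|` B ->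
      forall x, ((proj_nnsfun h mC) x)%:E <= (f \_ C) x.
    move=> CAB x; rewrite /= mindicE /patch; case: ifPn => xC; last by rewrite mulr0.
    rewrite mulr1; apply: (le_trans (hf x)); rewrite /patch ifT//.
    by move: xC; rewrite !inE => /CAB.
  apply: leeD; apply: ereal_sup_ubound; [exists (proj_nnsfun h mA)|
    exists (proj_nnsfun h mB)] => //=; exact: proj_le.
set L := (X in _ <= X).
have add_le (h1 h2 : {nnsfun T >-> R}) : (forall x, (h1 x)%:E <= (f \_ A) x) ->
    (forall x, (h2 x)%:E <= (f \_ B) x) ->
    sintegral mu h1 + sintegral mu h2 <= L.
  move=> h1f h2f; rewrite -sintegralD//; apply: ereal_sup_ubound.
  exists (add_nnsfun h1 h2) => //= x.
  have := h1f x; have := h2f x; rewrite /patch in_setU EFinD.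
  case: (boolP (x \in A)) => xA; case: (boolP (x \in B)) => xB /=.
  - by move: xA xB; rewrite !inE => xA xB; case: (AB x); split.
  - by move=> ? ?; rewrite -[leRHS]adde0; exact: leeD.
  - by move=> ? ?; rewrite -[leRHS]add0e; exact: leeD.
  - by move=> ? ?; rewrite -[leRHS]add0e; exact: leeD.
(* Once [L] is finite, the other quantities are finite too, and [h1] and [h2] are taken to their
   suprema one at a time, by subtraction. *)
have [->|Ly] := eqVneq L +oo; first exact: leey.
have L0 : 0 <= L.
  by apply: le_trans (add_le nnsfun0 nnsfun0 _ _); rewrite ?sintegral0 ?adde0//
    => x; rewrite /patch; case: ifP.
have Lf : L \is a fin_num by rewrite fin_numElt (lt_le_trans _ L0)//= ltey.
have finL (h : {nnsfun T >-> R}) : sintegral mu h <= L ->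
    sintegral mu h \is a fin_num.
  move=> hL; rewrite fin_numElt (lt_le_trans _ (sintegral_ge0 _ _))//=.
  by rewrite (le_lt_trans hL)// ltey.
have sB : ereal_sup [set sintegral mu h | h in
    [set h : {nnsfun T >-> R} | forall x, (h x)%:E <= (f \_ B) x]] <= L.
  apply: ge_ereal_sup => _ [h2 h2f <-].
  rewrite -[leLHS]add0e -{1}(@sintegral0 _ T _ mu); apply: (add_le nnsfun0) => //.
  by move=> x /=; rewrite /patch; case: ifP.
set sB' := ereal_sup _ in sB *.
have sB0 : 0 <= sB'.
  apply: ereal_sup_ubound; exists nnsfun0; last exact: sintegral0.
  by move=> x /=; rewrite /patch; case: ifP.
have sBf : sB' \is a fin_num.
  by rewrite fin_numElt (lt_le_trans _ sB0)//= (le_lt_trans sB)// ltey.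
rewrite -leeBrDr//; apply: ge_ereal_sup => _ [h1 h1f <-].
have h1L : sintegral mu h1 \is a fin_num.
  apply: finL; rewrite -[leLHS]adde0 -{1}(@sintegral0 _ T _ mu).
  by apply: (add_le _ nnsfun0) => // x /=; rewrite /patch; case: ifP.
rewrite leeBrDr// addeC -leeBrDr//; apply: ge_ereal_sup => _ [h2 h2f <-].
by rewrite leeBrDr// addeC; exact: add_le.
Qed.

Lemma ge0_integral_setC A f : measurable A -> (forall x, 0 <= f x) ->
  \int[mu]_x f x = \int[mu]_(x in A) f x + \int[mu]_(x in ~` A) f x.
Proof.
move=> mA f0; rewrite -ge0_integral_disjointU ?setUv//; first exact: measurableC.
by apply/disj_setPS; rewrite setICr.
Qed.

Lemma ge0_integral_subset A B f : measurable A -> measurable B -> A `<=` B ->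
  (forall x, 0 <= f x) ->
  \int[mu]_(x in A) f x <= \int[mu]_(x in B) f x.
Proof.
move=> mA mB AB f0; rewrite -(setDUK AB) ge0_integral_disjointU//.
- by rewrite leeDl// integral_ge0.
- exact: measurableD.
- by apply/disj_setPS => x [? []].
Qed.

(** Multiplying by [c^-1] turns a simple function below [c f] into one below [f]; the case [c = 0]
    is apart. *)
Lemma ge0_integralZ_le D f (c : R) : (0 <= c)%R -> (forall x, 0 <= f x) ->
  \int[mu]_(x in D) (c%:E * f x) <= c%:E * \int[mu]_(x in D) f x.
Proof.
rewrite le_eqVlt => /predU1P[<- _|c0 f0].
  by rewrite mul0e integral0_eq// => x _; rewrite mul0e.
rewrite !ge0_integralE//; last by move=> x _; rewrite mule_ge0// lee_fin ltW.
apply: ge_ereal_sup => _ [h hf <-].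
have ci0 : (0 <= c^-1)%R by rewrite invr_ge0 ltW.
rewrite -lee_pdivrMl// -sintegralrM; apply: ereal_sup_ubound.
exists (scale_nnsfun h ci0) => //= x.
by have := hf x; rewrite EFinM lee_pdivrMl// /patch; case: ifP => // _; rewrite mule0.
Qed.
End lower_integral.

(** * Directional derivatives, maxima and remainder bounds *)

Section calculus.
Context (R : realType) (n : nat).
Local Open Scope ring_scope.

Lemma derive_compR (F : 'rV[R]_n -> R^o) (phi dphi : R -> R) u v :
  differentiable F u -> (forall x : R, is_derive x 1 phi (dphi x)) ->
  differentiable (phi \o F : _ -> R^o) u /\
  'D_v (phi \o F : _ -> R^o) u = dphi (F u) * 'D_v F u.
Proof.
move=> dF dphiE.
have dp : differentiable phi (F u).
  by apply/derivable1_diffP; exact: @ex_derive.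
have dc : differentiable (phi \o F : _ -> R^o) u by exact: differentiable_comp.
split => //; rewrite deriveE// diff_comp//= deriveE// diff1E// derive1E.
by rewrite derive_val mulrC.
Qed.

(** Right difference quotients at a maximum are nonpositive, so the derivative is at most 0 along
    [v] and along [- v]. *)
Lemma derive_global_max (F : 'rV[R]_n -> R^o) u v :
  differentiable F u -> (forall w, F w <= F u) -> 'D_v F u = 0.
Proof.
move=> dF Fmax.
have Dle0 w : 'D_w F u <= 0.
  have cF := @diff_derivable _ _ _ F u w dF.
  have cFr : h^-1 *: ((F \o shift u) (h *: w) - F u) @[h --> 0^'+] --> 'D_w F u.
    apply: cvg_trans cF; apply: cvg_app.
    by move=> A [e e0 Ae]; exists e => // x xe x0; apply: Ae => //; exact: lt0r_neq0.
  rewrite -(cvg_lim _ cFr)//; apply: limr_le; first by apply/cvg_ex; exists ('D_w F u).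
  near=> h; rewrite mulr_ge0_le0 ?subr_le0//; last exact: Fmax.
  by rewrite invr_ge0 ltW.
apply/eqP; rewrite eq_le Dle0/= -oppr_le0.
by have := Dle0 (- v); rewrite !deriveE// linearN.
Unshelve. all: by end_near. Qed.

(** Meant for the piecewise quadratic cutoff: a remainder bound covers the knots and the smooth
    pieces at once. *)
Lemma is_derive_quadratic (phi : R -> R) (x d C : R) : 0 < C ->
  (forall h, `|phi (x + h) - phi x - d * h| <= C * h ^+ 2) -> is_derive x 1 phi d.
Proof.
move=> C0 phiq.
have c : h^-1 *: ((phi \o shift x) (h *: 1) - phi x) @[h --> 0^'] --> d.
  apply/cvgrPdist_le => e e0; near=> h.
  have h0 : h != 0 by near: h; exact: nbhs_dnbhs_neq.
  rewrite /= [h *: 1]mulr1 distrC;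
  rewrite -(@ler_pM2l _ `|h|) ?normr_gt0// -normrM mulrBr mulrA mulfV// mul1r.
  rewrite [h + x]addrC [h * d]mulrC; apply: (le_trans (phiq h)).
  rewrite -[h ^+ 2]ger0_norm ?sqr_ge0// normrX expr2 mulrCA ler_wpM2l//.
  rewrite mulrC -ler_pdivlMr//; near: h; apply: dnbhs0_le; exact: divr_gt0.
apply: DeriveDef; first by apply/cvg_ex; exists d.
exact: cvg_lim c.
Unshelve. all: by end_near. Qed.
End calculus.

(** * C^1 functions and their gradients on the manifold *)

Lemma continuous_for_near_eq (T U : topologicalType) (F G : T -> U) u :
  (\forall w \near u, F w = G w) ->
  {for u, continuous F} -> {for u, continuous G}.
Proof.
move=> FG cF; rewrite /prop_for /continuous_at -(nbhs_singleton FG).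
by apply: cvg_trans cF; exact: near_eq_cvg.
Qed.

Section manifold.
Context (R : realType) (n : nat) (M : riemannianManifold R n).
Implicit Types (f g : M -> R) (x : M).
Local Open Scope ring_scope.

Lemma chart_im_at x : chart_im (chart_at x) (chart_map (chart_at x) x).
Proof. by exists x => //; exact: (svalP (cid (chart_cover x))). Qed.

Lemma chart_inv_at x : chart_inv (chart_at x) (chart_map (chart_at x) x) = x.
Proof. by apply: chart_mapK; exact: (svalP (cid (chart_cover x))). Qed.

Lemma C1_continuous f : C1 f -> continuous f.
Proof.
move=> f1 x; set i := chart_at x.
have dx : chart_dom i x := svalP (cid (chart_cover x)).
have [df _] := f1 i.
apply: (@continuous_for_near_eq _ _ ((f \o chart_inv i) \o chart_map i)).
  have : \forall y \near x, chart_dom i y.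
    by apply: open_nbhs_nbhs; split => //; exact: chart_dom_open.
  by apply: filterS => y dy /=; rewrite chart_mapK.
apply: continuous_comp; first exact: chart_map_continuous.
by apply: differentiable_continuous; apply: df; exact: chart_im_at.
Qed.

Lemma C1_measurable f : C1 f -> measurable_fun [set: borel M] (f : borel M -> R).
Proof.
move=> f1; apply: (measurability _ (RGenOInfty.measurableE R)) => //.
move=> _ [_ [r ->] <-]; rewrite setTI; apply: sub_sigma_algebra.
apply: open_comp => [x _|]; first exact: C1_continuous.
exact: interval_open.
Qed.

(** Stated at a single point and through differentials, it serves both the chain rule and a linear
    combination in which one differential vanishes. *)
Lemma sqnorm_gradientZ f g (c : R) x : differential f x = c *: differential g x ->
  sqnorm_gradient f x = c ^+ 2 * sqnorm_gradient g x.
Proof.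
move=> dE; rewrite /sqnorm_gradient /gradient dE -!scalemxAl linearZ/= -scalemxAr.
by rewrite !mxE mulrA expr2.
Qed.

Lemma C1_comp f (phi dphi : R -> R) :
  (forall r : R, is_derive r 1 phi (dphi r)) -> continuous dphi -> C1 f ->
  C1 (phi \o f : M -> R) /\
  forall x, sqnorm_gradient (phi \o f) x = dphi (f x) ^+ 2 * sqnorm_gradient f x.
Proof.
move=> phiE cdphi f1; split.
  move=> i; have [df cf] := f1 i; split.
    by move=> u iu; have [] := derive_compR 0 (df u iu) phiE.
  move=> v u iu.
  apply: (@continuous_for_near_eq _ _
    (fun w => dphi ((f \o chart_inv i) w) * 'D_v (f \o chart_inv i : _ -> R^o) w)).
    near=> w; have iw : chart_im i w.
      by near: w; apply: open_nbhs_nbhs; split => //; exact: chart_im_open.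
    by have [_ ->] := derive_compR v (df w iw) phiE.
  apply: continuousM; last exact: cf.
  apply: continuous_comp; last exact: cdphi.
  exact/differentiable_continuous/df.
move=> x; have [df _] := f1 (chart_at x).
have dE : differential (phi \o f) x = dphi (f x) *: differential f x.
  apply/rowP => j; rewrite !mxE.
  by have [_ ->] := derive_compR (delta_mx 0 j) (df _ (chart_im_at x)) phiE;
    rewrite /= chart_inv_at.
exact: sqnorm_gradientZ dE.
Unshelve. all: by end_near. Qed.

Lemma sqnorm_gradient_ge0 f x : 0 <= sqnorm_gradient f x.
Proof.
rewrite /sqnorm_gradient; have [->|g0] := eqVneq (gradient f x) 0.
  by rewrite !mul0mx mxE.
exact/ltW/metric_posdef/g0/chart_im_at.
Qed.

Lemma derive_lin (F G : 'rV[R]_n -> R^o) (a b : R) u v :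
  differentiable F u -> differentiable G u ->
  differentiable (fun w => a * F w + b * G w : R^o) u /\
  'D_v (fun w => a * F w + b * G w : R^o) u = a * 'D_v F u + b * 'D_v G u.
Proof.
move=> dF dG.
have daF : differentiable (a *: F) u by exact: differentiableZ.
have dbG : differentiable (b *: G) u by exact: differentiableZ.
split; first exact: (differentiableD daF dbG).
rewrite (@deriveD _ _ _ (a *: F) (b *: G)); [|exact: diff_derivable..].
by rewrite !deriveZ//; exact: diff_derivable.
Qed.

Lemma C1_lin f g (a b : R) : C1 f -> C1 g -> C1 (fun x => a * f x + b * g x).
Proof.
move=> f1 g1 i; have [df cf] := f1 i; have [dg cg] := g1 i; split.
  by move=> u iu; have [] := derive_lin a b 0 (df u iu) (dg u iu).
move=> v u iu.
apply: (@continuous_for_near_eq _ _ (fun w =>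
    a * 'D_v (f \o chart_inv i : _ -> R^o) w +
    b * 'D_v (g \o chart_inv i : _ -> R^o) w)).
  near=> w; have iw : chart_im i w.
    by near: w; apply: open_nbhs_nbhs; split => //; exact: chart_im_open.
  by have [_ ->] := derive_lin a b v (df w iw) (dg w iw).
by apply: continuousD; apply: continuousM; [exact: cst_continuous|exact: cf|
  exact: cst_continuous|exact: cg].
Unshelve. all: by end_near. Qed.

Lemma differential_lin f g (a b : R) x : C1 f -> C1 g ->
  differential (fun x => a * f x + b * g x) x =
  a *: differential f x + b *: differential g x.
Proof.
move=> f1 g1; apply/rowP => j; rewrite !mxE.
have [df _] := f1 (chart_at x); have [dg _] := g1 (chart_at x).
have ix := chart_im_at x.
by have [_ <-] := derive_lin a b (delta_mx 0 j) (df _ ix) (dg _ ix).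
Qed.

Lemma differential_max f x : C1 f -> (forall y, f y <= f x) ->
  differential f x = 0.
Proof.
move=> f1 fx; apply/rowP => j; rewrite !mxE.
have [df _] := f1 (chart_at x).
apply: derive_global_max => [|w]; first exact/df/chart_im_at.
by rewrite /= chart_inv_at.
Qed.

Lemma differential_min f x : C1 f -> (forall y, f x <= f y) ->
  differential f x = 0.
Proof.
move=> f1 fx; have := @differential_max (fun x => -1 * f x + 0 * f x) x.
rewrite differential_lin// scaleN1r scale0r addr0 => /(_ (C1_lin _ _ f1 f1)) max0.
by apply: oppr_inj; rewrite oppr0 max0// => y; rewrite !mulN1r !mul0r !addr0 lerN2.
Qed.

End manifold.

(** * A C^1 cutoff function on the line *)

Section bump.
Context (R : realType).
Local Open Scope ring_scope.

Definition sqp (x : R) : R := Num.max x 0 ^+ 2.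

Lemma sqp_quadratic (x h : R) :
  0 <= sqp (x + h) - sqp x - 2 * Num.max x 0 * h <= h ^+ 2.
Proof. by rewrite /sqp; case: (leP x 0) => ?; case: (leP (x + h) 0) => ?; nra. Qed.

(* Quadratic spline with knots 0, 1/2, 1, going from 0 to 1. *)
Definition step (x : R) : R := 2 * sqp x - 4 * sqp (x - 2^-1) + 2 * sqp (x - 1).

(** The derivative of [step], a tent on [0, 1] with peak 2 at 1/2. *)
Definition dstep (x : R) : R :=
  4 * Num.max x 0 - 8 * Num.max (x - 2^-1) 0 + 4 * Num.max (x - 1) 0.

Lemma step_itv (x : R) : 0 <= step x <= 1.
Proof.
rewrite /step /sqp; case: (leP x 0) => ?; case: (leP (x - 2^-1) 0) => ?;
  case: (leP (x - 1) 0) => ?; nra.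
Qed.

Lemma step_le0 (x : R) : x <= 0 -> step x = 0.
Proof.
move=> x0; rewrite /step /sqp !max_r; [by rewrite expr0n/= !mulr0; ring|lra..].
Qed.

Lemma step_ge1 (x : R) : 1 <= x -> step x = 1.
Proof. by move=> x1; rewrite /step /sqp !max_l; [field|lra..]. Qed.

Lemma dstep_sqr_le (x : R) : dstep x ^+ 2 <= 4.
Proof.
rewrite /dstep; case: (leP x 0) => ?; case: (leP (x - 2^-1) 0) => ?;
  case: (leP (x - 1) 0) => ?; nra.
Qed.

Lemma dstep_eq0 (x : R) : x <= 0 \/ 1 <= x -> dstep x = 0.
Proof.
move=> [x0|x1]; rewrite /dstep.
- by rewrite !max_r; [ring|lra..].
- by rewrite !max_l; [field|lra..].
Qed.

Lemma is_derive_step (c r : R) : 0 < c ->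
  is_derive r 1 (fun x => step (c * x - 1)) (c * dstep (c * r - 1)).
Proof.
move=> c0; have C0 : 0 < 8 * c ^+ 2 by rewrite mulr_gt0// exprn_gt0.
apply: (is_derive_quadratic C0) => h.
have -> : c * (r + h) - 1 = c * r - 1 + c * h by ring.
set x := c * r - 1; set k := c * h.
have -> : c * dstep x * h = dstep x * k by rewrite /k; ring.
have -> : 8 * c ^+ 2 * h ^+ 2 = 8 * k ^+ 2 by rewrite /k; ring.
(* The three remainders lie in [0, k^2] and enter with coefficients 2, -4 and 2, whose absolute
   values add up to 8. *)
have := sqp_quadratic x k; have := sqp_quadratic (x - 2^-1) k.
have := sqp_quadratic (x - 1) k; rewrite /step /dstep.
have -> : x + k - 2^-1 = x - 2^-1 + k by ring.
have -> : x + k - 1 = x - 1 + k by ring.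
move=> /andP[? ?] /andP[? ?] /andP[? ?]; rewrite ler_norml; apply/andP; split; lra.
Qed.

Lemma continuous_dstep (c : R) : continuous (fun x => c * dstep (c * x - 1)).
Proof.
have cmax (a b : R) : continuous (fun x : R => Num.max (a * x - b) 0).
  move=> x.
  apply: (@continuous_max _ _ (fun x => a * x - b) (cst 0)); last exact: cst_continuous.
  apply: (@continuousB _ _ _ (fun x : R => a * x : R^o) (cst b));
    last exact: cst_continuous.
  by apply: (@continuousM _ _ (cst a) id); [exact: cst_continuous|].
rewrite (_ : (fun x => _) = (fun x => c * (4 * Num.max (c * x - 1) 0
   - 8 * Num.max (c * x - (1 + 2^-1)) 0 + 4 * Num.max (c * x - (1 + 1)) 0))); last first.
  by apply/funext => y; rewrite /dstep !opprD !addrA.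
have cMmax (e b : R) : continuous (fun x : R => e * Num.max (c * x - b) 0).
    by move=> x; apply: (@continuousM _ _ (cst e) (fun x : R => Num.max (c * x - b) 0));
    [exact: cst_continuous|exact: cmax].
move=> x; apply: (@continuousM _ _ (cst c)
    ((fun x => 4 * Num.max (c * x - 1) 0) \- (fun x => 8 * Num.max (c * x - (1 + 2^-1)) 0)
     \+ (fun x => 4 * Num.max (c * x - (1 + 1)) 0))); first exact: cst_continuous.
apply: (@continuousD _ R^o); last exact: cMmax.
by apply: (@continuousB _ R^o); exact: cMmax.
Qed.
End bump.

(** * Energy of compositions and of glued functions *)

Lemma indic_le (R : numDomainType) (T : Type) (A B : set T) (x : T) :
  A `<=` B -> (\1_A x <= \1_B x :> R)%R.
Proof.
move=> AB; rewrite !indicE ler_nat; case: (boolP (x \in A)) => //=.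
by rewrite inE => /AB xB; rewrite mem_set.
Qed.

Section energy.
Context (R : realType) (n : nat) (M : riemannianManifold R n).
Variable nu : {measure set (borel M) -> \bar R}.
Implicit Types (f g : M -> R) (x : M) (A B C : set (borel M)).

Lemma energy_ge0 f : 0 <= energy nu f.
Proof. by apply: integral_ge0 => x _; rewrite lee_fin sqnorm_gradient_ge0. Qed.

(** By the chain rule the integrand vanishes off [A]. With [A] a band between two levels of [f],
    this localizes the energy of a truncation. *)
Lemma energy_comp_le f (phi dphi : R -> R) (K : R) A : measurable A ->
  (forall r : R, is_derive r 1%R phi (dphi r)) -> continuous dphi -> C1 f ->
  (forall x, (dphi (f x) ^+ 2 <= K)%R) -> (forall x, ~ A x -> dphi (f x) = 0%R) ->
  energy nu (phi \o f) <= K%:E * \int[nu]_(x in A) (sqnorm_gradient f x)%:E.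
Proof.
move=> mA phiE cdphi f1 dK dA.
have [_ gE] := C1_comp phiE cdphi f1.
have f0 x : 0 <= (sqnorm_gradient f x)%:E by rewrite lee_fin sqnorm_gradient_ge0.
have K0 : (0 <= K)%R by apply: le_trans (dK point); exact: sqr_ge0.
rewrite /energy (ge0_integral_setC _ mA); last first.
  by move=> x; rewrite lee_fin sqnorm_gradient_ge0.
rewrite [X in _ + X]integral0_eq ?adde0; last first.
  by move=> x Ax; rewrite gE dA// expr0n mul0r.
apply: le_trans (ge0_integralZ_le nu A K0 f0).
apply: ge0_integral_le => x _; first by rewrite lee_fin sqnorm_gradient_ge0.
by rewrite gE -EFinM lee_fin ler_wpM2r// sqnorm_gradient_ge0.
Qed.

(* The gradient of [g] vanishes on [B], where [g] is maximal, and that of [f]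
   off [B], where [f] is minimal: there is no cross term. *)
Lemma energy_chain f g (a b : R) A B C : measurable B -> C1 f -> C1 g ->
  (0 <= a)%R -> (0 <= b)%R -> (a + b = 1)%R -> A `<=` B -> B `<=` C ->
  (forall x, (\1_A x <= f x <= \1_B x)%R) ->
  (forall x, (\1_B x <= g x <= \1_C x)%R) ->
  exists h : M -> R, [/\ C1 h, forall x, (\1_A x <= h x <= \1_C x)%R &
    energy nu h <= (a ^+ 2)%:E * energy nu f + (b ^+ 2)%:E * energy nu g].
Proof.
move=> mB f1 g1 a0 b0 ab AB BC fAB gBC.
exists (fun x => a * f x + b * g x)%R.
have indic01 (D : set M) x : (0 <= (\1_D x : R) <= 1)%R.
  by rewrite indicE ler0n lern1 leq_b1.
have f01 x : (0 <= f x <= 1)%R.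
  have /andP[? ?] := fAB x; have /andP[? ?] := indic01 A x.
  by have /andP[? ?] := indic01 B x; lra.
have g01 x : (0 <= g x <= 1)%R.
  have /andP[? ?] := gBC x; have /andP[? ?] := indic01 B x.
  by have /andP[? ?] := indic01 C x; lra.
split; first exact: C1_lin.
- move=> x; have /andP[? ?] := fAB x; have /andP[? ?] := gBC x.
  have ? : (\1_A x <= \1_B x :> R)%R by exact: indic_le.
  have ? : (\1_B x <= \1_C x :> R)%R by exact: indic_le.
  by apply/andP; split; nra.
- have sq0 u x : 0 <= (sqnorm_gradient (M := M) u x)%:E.
    by rewrite lee_fin sqnorm_gradient_ge0.
  rewrite {1}/energy (ge0_integral_setC _ mB); last by move=> x; exact: sq0.
  apply: leeD.
  + apply: (@le_trans _ _ ((a ^+ 2)%:E * \int[nu]_(x in B) (sqnorm_gradient f x)%:E)).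
      apply: le_trans (ge0_integralZ_le nu B (sqr_ge0 a) (sq0 f)).
      apply: ge0_integral_le => x Bx; first exact: sq0.
      rewrite (@sqnorm_gradientZ _ _ _ _ f a) ?EFinM//.
      rewrite differential_lin// (differential_max g1) ?scaler0 ?addr0// => y.
      have /andP[+ _] := gBC x; rewrite indicE mem_set//= => g1x.
      by have /andP[_ /le_trans] := g01 y; apply.
    apply: lee_wpmul2l; first by rewrite lee_fin sqr_ge0.
    rewrite /energy; apply: ge0_integral_subset => //; exact: sq0.
  + apply: (@le_trans _ _ ((b ^+ 2)%:E * \int[nu]_(x in ~` B) (sqnorm_gradient g x)%:E)).
      apply: le_trans (ge0_integralZ_le nu (~` B) (sqr_ge0 b) (sq0 g)).
      apply: ge0_integral_le => x Bx; first exact: sq0.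
      rewrite (@sqnorm_gradientZ _ _ _ _ g b) ?EFinM//.
      rewrite differential_lin// (differential_min f1) ?scaler0 ?add0r// => y.
      have /andP[_ ] := fAB x; rewrite indicE memNset//= => f0x.
      by have /andP[+ _] := f01 y; apply: le_trans.
    apply: lee_wpmul2l; first by rewrite lee_fin sqr_ge0.
    rewrite /energy; apply: ge0_integral_subset => //; exact: measurableC.
Qed.
End energy.

(** * Variance of functions with small support *)

Section variance.
Context d (T : measurableType d) (R : realType) (P : probability T R).
Implicit Types (X : T -> R) (A : set T).

Lemma Lfun2_of_sqr X : measurable_fun [set: T] X ->
  \int[P]_x (X x ^+ 2)%:E < +oo -> X \in Lfun P 2%:E.
Proof.
move=> mX X2; rewrite inE; apply/andP; split; rewrite inE//= /finite_norm.
rewrite unlock poweR_lty// (eq_integral (fun x => (X x ^+ 2)%:E))// => x _.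
by rewrite /= powR_mulrn// -normrX ger0_norm ?sqr_ge0.
Qed.

Lemma Lfun2_bounded X (c : R) : measurable_fun [set: T] X ->
  (forall x, `|X x| <= c)%R -> X \in Lfun P 2%:E.
Proof.
move=> mX Xc; apply: Lfun2_of_sqr => //.
apply: (@le_lt_trans _ _ (\int[P]_x (c ^+ 2)%:E)).
  apply: ge0_integral_le => x _; rewrite lee_fin ?sqr_ge0//.
  by rewrite -[(X x ^+ 2)%R]ger0_norm ?sqr_ge0// normrX lerXn2r// nnegrE
    ?(le_trans _ (Xc x)).
by rewrite integral_cst// [X in _ * X](probability_setT P) mule1 ltry.
Qed.

(* [E (X - 2 E[X] 1_A)^2 >= 0] expands to [E[X^2] >= 4 (1 - P A) E[X]^2]. *)
Lemma variance_support_ge X A : measurable A -> P A <= (2^-1)%:E ->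
  X \in Lfun P 2%:E -> (forall x, ~ A x -> X x = 0%R) ->
  'E_P[X ^+ 2] <= 2%:E * 'V_P[X].
Proof.
move=> mA PA X2 XA.
have PT : P [set: T] \is a fin_num by rewrite probability_setT.
have X1 : X \in Lfun P 1 by exact: (Lfun_subset12 PT).
have XX1 : (X ^+ 2)%R \in Lfun P 1 by exact: (Lfun2_mul_Lfun1 X2 X2).
have A2 : (\1_A : T -> R) \in Lfun P 2%:E.
  apply: (@Lfun2_bounded _ 1); first exact: measurable_indic.
  by move=> x; rewrite indicE normr_nat lern1 leq_b1.
have A1 : (\1_A : T -> R) \in Lfun P 1 by exact: (Lfun_subset12 PT).
have [G GE] : exists G, 'E_P[X] = G%:E.
  by exists (fine 'E_P[X]); rewrite fineK// expectation_fin_num.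
have [Q QE] : exists Q, 'E_P[X ^+ 2] = Q%:E.
  by exists (fine 'E_P[X ^+ 2]); rewrite fineK// expectation_fin_num.
have [a aE] : exists a, P A = a%:E.
  by exists (fine (P A)); rewrite fineK// fin_num_measure.
have : 0 <= 'E_P[(X \- ((2 * G) \o* \1_A)) ^+ 2].
  by apply: expectation_ge0 => x; exact: sqr_ge0.
have -> : ((X \- ((2 * G) \o* \1_A)) ^+ 2 =
    ((X ^+ 2) \- ((4 * G) \o* X)) \+ ((4 * G ^+ 2) \o* \1_A))%R.
  apply/funext => x; rewrite /= !fctE/= indicE.
  have [Ax|Ax] := pselect (A x); first by rewrite mem_set//=; ring.
  by rewrite memNset// XA//=; ring.
have smul (c : R) (Y : T -> R) : Y \in Lfun P 1 -> (c \o* Y)%R \in Lfun P 1.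
  by move=> Y1; rewrite Lfun_scale.
rewrite expectationD ?rpredB ?smul// expectationB ?smul// !expectationZl//.
rewrite expectation_indic// varianceE// GE QE [X in _ + _ * X]aE.
move: PA; rewrite aE lee_fin => a12.
rewrite !(=^~ EFinM, =^~ EFinB, =^~ EFinD, =^~ EFin_expe) !lee_fin => ge0.
(* As [a <= 1/2], the expansion gives [Q >= 4 (1 - a) G^2 >= 2 G^2], that is [Q <= 2 (Q - G^2)]. *)
have := sqr_ge0 G; nra.
Qed.
End variance.

(** * Lower bound on the energy from the weak Poincare inequality *)

Section capacity_bound.
Context (R : realType) (n : nat) (M : riemannianManifold R n).
Variables (mu : probability (borel M) R) (nu : {measure set (borel M) -> \bar R}).
Variable beta : R -> R.
Hypothesis wp : weak_poincare mu nu beta.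
Implicit Types (f g : M -> R) (A Omega : set (borel M)).

Lemma Osc_sqr_le1 f : (forall x, 0 <= f x <= 1)%R -> Osc mu f ^+ 2 <= 1.
Proof.
move=> f01; rewrite /Osc.
have muT : 0 < mu [set: borel M] by rewrite probability_setT.
have f0 x : 0 <= (f x)%:E by rewrite lee_fin; have /andP[] := f01 x.
have f1 x : (f x)%:E <= 1 by rewrite lee_fin; have /andP[] := f01 x.
have s1 : ess_sup mu (EFin \o f) <= 1 by apply/ess_supP/nearW => x; exact: f1.
have i0 : 0 <= ess_inf mu (EFin \o f) by apply/ess_infP/nearW => x; exact: f0.
have s0 : 0 <= ess_sup mu (EFin \o f).
  by apply: ess_sup_gee => //; apply: nearW => x; exact: f0.
have i1 : ess_inf mu (EFin \o f) <= 1 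
  by rewrite -(ess_inf_cst 1 muT); apply/le_ess_inf/nearW => x; exact: f1.
have [s sE] : exists s, ess_sup mu (EFin \o f) = s%:E.
  exists (fine (ess_sup mu (EFin \o f))); rewrite fineK//.
  by rewrite fin_numElt (lt_le_trans _ s0)//= (le_lt_trans s1)// ltry.
have [i iE] : exists i, ess_inf mu (EFin \o f) = i%:E.
  exists (fine (ess_inf mu (EFin \o f))); rewrite fineK//.
  by rewrite fin_numElt (lt_le_trans _ i0)//= (le_lt_trans i1)// ltry.
move: s0 s1 i0 i1; rewrite sE iE -EFinB -EFin_expe !lee_fin => *; nra.
Qed.

(** The choice [s = a/4] makes the oscillation term absorbable: [a <= 2 Var f] and
    [Var f <= beta E + a/4] leave [a/2 <= 2 beta E]. *)
Lemma energy_ge_measure A Omega f : measurable A -> measurable Omega ->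
  mu Omega <= (2^-1)%:E -> C1 f -> (forall x, \1_A x <= f x <= \1_Omega x)%R ->
  (0 < fine (mu A))%R ->
  (fine (mu A) / 4)%:E <= (beta (fine (mu A) / 4))%:E * energy nu f.
Proof.
move=> mA mO muO f1 fAO a0; have [_ _ wpf] := wp.
set a := fine (mu A) in a0 *.
have aE : mu A = a%:E by rewrite fineK// fin_num_measure.
have f01 x : (0 <= f x <= 1)%R.
  have /andP[Af fO] := fAO x; apply/andP; split.
    by apply: le_trans Af; rewrite indicE ler0n.
  by apply: (le_trans fO); rewrite indicE lern1 leq_b1.
have fn1 x : (`|f x| <= 1)%R by have /andP[? ?] := f01 x; rewrite ger0_norm.
have bf : bounded_fun f.
  exists 1%R; split; first exact: num_real.
  by move=> y y1 x _ /=; rewrite (le_trans (fn1 x))// ltW.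
have mf := C1_measurable f1.
have f2 : (f : borel M -> R) \in Lfun mu 2%:E by exact: (Lfun2_bounded mu mf fn1).
have a40 : (0 < a / 4)%R by rewrite divr_gt0.
have Ea : a%:E <= 'E_mu[(f : borel M -> R) ^+ 2].
  rewrite -aE -(expectation_indic mu mA).
  apply: expectation_le.
  - exact: measurable_indic.
  - exact: (measurable_funX 2 mf).
  - by [].
  - by move=> x; exact: sqr_ge0.
  apply: nearW => x; rewrite indicE; have [/[!inE] Ax|_] := boolP (x \in A).
    have /andP[+ _] := fAO x; rewrite indicE mem_set// => f1x.
    by rewrite fctE exprn_ege1.
  exact: sqr_ge0.
have f0 x : ~ Omega x -> f x = 0%R.
  move=> Ox; have /andP[f0x _] := f01 x; have /andP[_] := fAO x.
  by rewrite indicE memNset//= => fx0; apply/eqP; rewrite eq_le fx0.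
have := variance_support_ge mO muO f2 f0; move=> /(le_trans Ea) aV.
have := wpf f (a / 4)%R f1 bf a40.
set b := (beta (a / 4))%:E * energy nu f => Vb.
have [->|by_] := eqVneq b +oo; first exact: leey.
have b0 : 0 <= b.
  by rewrite mule_ge0 ?energy_ge0// lee_fin; have [+ _ _] := wp; apply.
have bf' : b \is a fin_num by rewrite ge0_fin_numE// ltey.
have {}Vb : 'V_mu[f] <= b + (a / 4)%:E.
  apply: (le_trans Vb); rewrite leeD2l// -[leRHS]mule1.
  by rewrite lee_wpmul2l ?Osc_sqr_le1// lee_fin ltW.
have : a%:E <= 2%:E * (b + (a / 4)%:E).
  by apply: (le_trans aV); rewrite lee_wpmul2l// lee_fin.
rewrite -(fineK bf') -EFinD -EFinM !lee_fin; lra.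
Qed.
End capacity_bound.

(** * A primitive of the integrand *)

Section profile.
Context (R : realType) (beta : R -> R) (p : R).
Hypothesis beta_ge0 : forall s : R, (0 < s)%R -> (0 <= beta s)%R.
Hypothesis beta_noninc :
  forall s t : R, (0 < s)%R -> (s <= t)%R -> (beta t <= beta s)%R.
Hypothesis p_ge0 : (0 <= p)%R.
Hypothesis int_fin : \int[lebesgue_measure]_(t in `]0%R, (2^-1)%R])
  (beta (t / 4) `^ p)%:E < +oo.

(** [J a] is the integral over []0, a]]. Since [beta] is nonincreasing, the integrand on []a, b]] is
    at least its value at [b]. The sums below see the integral only through this increment bound. *)
Lemma profile_primitive : exists J : R -> R, [/\ J 0%R = 0%R,
  (J 2^-1%R)%:E = \int[lebesgue_measure]_(t in `]0%R, (2^-1)%R])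
    (beta (t / 4) `^ p)%:E &
  forall a b : R, (0 <= a)%R -> (a <= b)%R -> (0 < b)%R -> (b <= 2^-1)%R ->
    (J a + (b - a) * beta (b / 4) `^ p <= J b)%R].
Proof.
pose u (t : R) : \bar R := (beta (t / 4) `^ p)%:E.
have u0 t : 0 <= u t by rewrite lee_fin powR_ge0.
pose I (a : R) := \int[lebesgue_measure]_(t in `]0%R, a]) u t.
have Ifin a : (a <= 2^-1)%R -> I a \is a fin_num.
  move=> a2; rewrite ge0_fin_numE ?integral_ge0//; apply: le_lt_trans int_fin.
  apply: ge0_integral_subset => // t /=; rewrite !in_itv/= => /andP[-> ta].
  exact: le_trans ta a2.
exists (fun a => fine (I a)); split.
- by rewrite /I set_itv_ge ?bnd_simp// integral_set0.
- by rewrite fineK// Ifin.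
- move=> a b a0 ab b0 b2.
  rewrite -lee_fin EFinD !fineK ?Ifin ?(le_trans ab)//.
  have -> : I b = I a + \int[lebesgue_measure]_(t in `]a, b]) u t.
    have dis : [disjoint `]0%R, a] & `]a, b]].
      apply/disj_setPS => t [] /=; rewrite !in_itv/= => /andP[_ ta] /andP[at_ _].
      by move: at_; rewrite ltNge ta.
    have := ge0_integral_disjointU lebesgue_measure (measurable_itv `]0%R, a])
      (measurable_itv `]a, b]) dis u0.
    by rewrite -itv_bndbnd_setU ?bnd_simp.
  rewrite leeD2l//.
  apply: (@le_trans _ _ (\int[lebesgue_measure]_(t in `]a, b]) (beta (b / 4) `^ p)%:E)).
    rewrite integral_cst//= lebesgue_measure_itv/= lte_fin.
    case: ltgtP ab => // [ab _|->]; first by rewrite -EFinB muleC.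
    by rewrite subrr mul0r mule0.
  apply: ge0_integral_le => t; rewrite /= in_itv/= => /andP[at_ tb].
    by rewrite lee_fin powR_ge0.
  have t0 : (0 < t)%R by exact: le_lt_trans at_.
  rewrite lee_fin ge0_ler_powR// ?nnegrE ?beta_ge0 ?divr_gt0//.
  by apply: beta_noninc; rewrite ?divr_gt0// ler_pM2r.
Qed.
End profile.

(** * Abel summation for real sequences *)

Section real_sums.
Context (R : realType) (beta J : R -> R) (p : R).
Local Open Scope ring_scope.
Hypothesis p_ge1 : 1 <= p.
Hypothesis beta_ge0 : forall s : R, 0 < s -> 0 <= beta s.
Hypothesis J_incr : forall a b : R, 0 <= a -> a <= b -> 0 < b -> b <= 2^-1 ->
    J a + (b - a) * beta (b / 4) `^ p <= J b.

Lemma J_homo a b : 0 <= a -> a <= b -> b <= 2^-1 -> J a <= J b.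
Proof.
move=> a0 ab b2; have [b0|b0] := ltP 0 b; last first.
  by have -> : a = b by apply/eqP; rewrite eq_le ab (le_trans b0).
apply: le_trans (J_incr a0 ab b0 b2).
by rewrite lerDl mulr_ge0 ?powR_ge0// subr_ge0.
Qed.

(* Young's inequality for the conjugate exponents 1 + p and (1 + p) / p. *)
Lemma powR_bernoulli (a b : R) : 0 <= a -> a <= b ->
  b `^ (1 + p) - a `^ (1 + p) <= (1 + p) * b `^ p * (b - a).
Proof.
move=> a0 ab; have b0 := le_trans a0 ab.
have p0 : 0 < p := lt_le_trans ltr01 p_ge1.
have P0 : 0 < 1 + p := addr_gt0 ltr01 p0.
have conj : (1 + p)^-1 + ((1 + p) / p)^-1 = 1.
  by field; rewrite !gt_eqF.
have := conjugate_powR a0 (powR_ge0 b p) P0 (divr_gt0 P0 p0) conj.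
rewrite -powRrM (_ : p * ((1 + p) / p) = 1 + p); last by field; rewrite gt_eqF.
have -> : b `^ (1 + p) = b * b `^ p.
  by rewrite -(mulr_powRB1 b0 P0) (_ : 1 + p - 1 = p)//; ring.
set A := a `^ (1 + p); set B := b `^ p => young.
have : (1 + p) * (a * B) <= (1 + p) * (A / (1 + p) + b * B / ((1 + p) / p)).
  by rewrite ler_pM2l.
have -> : (1 + p) * (A / (1 + p) + b * B / ((1 + p) / p)) = A + p * (b * B).
  by field; rewrite !gt_eqF.
nra.
Qed.

(** Write [z^p = z z^(p-1)], where [z^(p-1)] is nondecreasing because [p >= 1]. *)
Lemma powR_superadd (c d : R) : 0 <= c -> 0 <= d ->
  c `^ p + d `^ p <= (c + d) `^ p.
Proof.
move=> c0 d0; have p0 : 0 < p := lt_le_trans ltr01 p_ge1.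
rewrite -(mulr_powRB1 c0 p0) -(mulr_powRB1 d0 p0)
  -(mulr_powRB1 (addr_ge0 c0 d0) p0) mulrDl.
by apply: lerD; apply: ler_wpM2l => //; apply: ge0_ler_powR;
  rewrite ?nnegrE ?subr_ge0 ?addr_ge0// ?lerDl ?lerDr.
Qed.

(* Abel summation: the tails [D_i] of [sum c] satisfy [a_i D_i <= 4 beta (a_i / 4)],
   and [c_i^p <= D_i^p - D_(i+1)^p] by superadditivity. *)
Lemma chain_sum_le (a c : nat -> R) N :
  (forall i, 0 <= a i <= 2^-1) -> (forall i, a i <= a i.+1) ->
  (forall i, 0 <= c i) ->
  (forall i, (i <= N)%N -> 0 < a i ->
    a i * \sum_(i <= j < N) c j <= 4 * beta (a i / 4)) ->
  \sum_(0 <= i < N) a i `^ (1 + p) * c i `^ p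
    <= (1 + p) * 4 `^ p * (J 2^-1 - J 0).
Proof.
move=> a01 aS c0 ac; have p0 : 0 < p := lt_le_trans ltr01 p_ge1.
have P0 : 0 < 1 + p := addr_gt0 ltr01 p0.
pose D i := \sum_(i <= j < N) c j.
have D0 i : 0 <= D i by apply: sumr_ge0.
have a0 i : 0 <= a i by have /andP[] := a01 i.
have a2 i : a i <= 2^-1 by have /andP[] := a01 i.
have K0 : 0 <= 4 `^ p :> R by exact: powR_ge0.
have aPE i : a i `^ (1 + p) = a i * a i `^ p.
  by rewrite -(mulr_powRB1 (a0 i) P0) (_ : 1 + p - 1 = p)//; ring.
(* Used with [x = a_(i-1)] in each Abel step, and with [x = 0] for the boundary term. *)
have aD i x : (i <= N)%N -> 0 <= x -> x <= a i ->
    (a i - x) * (a i `^ p * D i `^ p) <= 4 `^ p * (J (a i) - J x).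
  move=> iN x0 xa; have [ai|ai] := ltP 0 (a i); last first.
    have -> : a i = x by apply/eqP; rewrite eq_le xa (le_trans ai).
    by rewrite !subrr mul0r mulr0.
  apply: (@le_trans _ _ ((a i - x) * (4 `^ p * beta (a i / 4) `^ p))).
    rewrite ler_wpM2l ?subr_ge0// -!powRM ?beta_ge0 ?divr_gt0//.
    apply: ge0_ler_powR; rewrite ?nnegrE ?mulr_ge0 ?beta_ge0 ?divr_gt0 ?(ltW p0)//.
    exact: ac.
  by rewrite mulrCA ler_wpM2l// lerBrDl; exact: J_incr.
(* Downward induction on [i], where [m = N - i] terms remain. The Bernoulli bound turns the jump of
   [a^(1+p)] into a jump of [J], and these telescope. *)
have claim m i : (i + m = N)%N ->
    \sum_(i <= j < N) a j `^ (1 + p) * c j `^ p <=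
    a i `^ (1 + p) * D i `^ p + (1 + p) * 4 `^ p * (J 2^-1 - J (a i)).
  elim: m i => [|m IH] i imN.
    rewrite addn0 in imN; subst i; rewrite big_geq// addr_ge0//.
      by rewrite mulr_ge0 ?powR_ge0.
    by rewrite !mulr_ge0 ?(ltW P0)// subr_ge0; exact: J_homo.
  have iN : (i < N)%N by lia.
  have {}IH := IH i.+1 ltac:(lia).
  rewrite big_ltn//.
  have DE : D i = c i + D i.+1 by rewrite /D big_ltn.
  have sup := powR_superadd (c0 i) (D0 i.+1).
  rewrite -DE in sup.
  have bern := powR_bernoulli (a0 i) (aS i).
  have key := aD i.+1 _ iN (a0 i) (aS i).
  have aP0 := powR_ge0 (a i) (1 + p).
  have Dp0 := powR_ge0 (D i.+1) p.
  have h1 := ler_wpM2r Dp0 bern.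
  have h2 := ler_wpM2l aP0 sup.
  have h3 := ler_wpM2l (ltW P0) key.
  rewrite mulrDr in h2.
  move: IH h1 h2 h3.
  set X := a i `^ (1 + p) * c i `^ p; set Y := a i `^ (1 + p) * D i `^ p.
  set Z := a i `^ (1 + p) * D i.+1 `^ p; set W := D i.+1 `^ p.
  set S := \sum_(i.+1 <= j < N) _; set A := a i.+1 `^ (1 + p).
  set B := a i.+1 `^ p; set K := 4 `^ p.
  rewrite -/Z mulrBl -/Z => IH h1 h2 h3; lra.
apply: (le_trans (claim N 0%N (add0n N))).
(* The boundary term is [a_0 (a_0 D_0)^p], at most [4^p (J a_0 - J 0)], which fits since
   [1 + p >= 1]. *)
have := aD 0%N 0 isT (lexx _) (a0 _); rewrite subr0 aPE -mulrA => h.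
have J1 : 0 <= 4 `^ p * (J (a 0%N) - J 0).
  by rewrite mulr_ge0// subr_ge0; exact: J_homo.
have : 0 <= p * (4 `^ p * (J (a 0%N) - J 0)) by rewrite mulr_ge0 ?(ltW p0).
lra.
Qed.
End real_sums.

(** * Capacities along an increasing chain of sets *)

Section chains.
Context (R : realType) (n : nat) (M : riemannianManifold R n).
Variables (mu : probability (borel M) R) (nu : {measure set (borel M) -> \bar R}).
Variable beta : R -> R.
Hypothesis wp : weak_poincare mu nu beta.
Implicit Types (f g : M -> R) (A B C Omega : set (borel M)).

Let beta_ge0 (s : R) : (0 < s)%R -> (0 <= beta s)%R.
Proof. by have [+ _ _] := wp; apply. Qed.

Lemma capacity_gt0 A Omega : measurable A -> measurable Omega ->
  mu Omega <= (2^-1)%:E -> (0 < fine (mu A))%R -> 0 < capacity nu A Omega.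
Proof.
move=> mA mO muO a0; set a := fine (mu A) in a0.
have a4 : (0 < a / 4)%R by rewrite divr_gt0.
(* [beta] may vanish at [a/4]; adding 1 gives a positive divisor. *)
have b1 : (0 < beta (a / 4) + 1)%R by rewrite ltr_wpDl// beta_ge0.
apply: (@lt_le_trans _ _ ((beta (a / 4) + 1)^-1 * (a / 4))%:E).
  by rewrite lte_fin mulr_gt0// invr_gt0.
apply: le_ereal_inf_tmp => _ [f [f1 fAO] <-].
rewrite EFinM lee_pdivrMl//.
apply: (le_trans (energy_ge_measure wp mA mO muO f1 fAO a0)).
by rewrite lee_wpmul2r ?energy_ge0// lee_fin lerDl.
Qed.

Variables (Omega : set (borel M)) (om : nat -> set (borel M)).
Hypothesis mOmega : measurable Omega.
Hypothesis muOmega : mu Omega <= (2^-1)%:E.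
Hypothesis mom : forall i, measurable (om i).
Hypothesis omS : forall i, om i `<=` om i.+1.
Hypothesis omO : forall i, om i `<=` Omega.

Let a i : R := fine (mu (om i)).

Let aE i : mu (om i) = (a i)%:E.
Proof. by rewrite fineK// fin_num_measure. Qed.

Let a_ge0 i : (0 <= a i)%R.
Proof. exact: fine_ge0. Qed.

Let aS i : (a i <= a i.+1)%R.
Proof. by rewrite -lee_fin -!aE le_measure// inE. Qed.

Let a_le i : (a i <= 2^-1)%R.
Proof. by rewrite -lee_fin -aE; apply: le_trans muOmega; rewrite le_measure// inE. Qed.

(** When [om i] is null its capacity may be 0, with inverse [+oo]; the value 0 is harmless because
    the corresponding term of the sum carries the factor [a_i^(1+p) = 0]. *)
Let c i : R := if (0 < a i)%R then fine (capacity nu (om i) (om i.+1))^-1 else 0%R.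

Let omle i : mu (om i) <= (2^-1)%:E.
Proof. by rewrite aE lee_fin. Qed.

Let c_ge0 i : (0 <= c i)%R.
Proof.
rewrite /c; case: ifP => // _; rewrite fine_ge0// inve_ge0.
by apply: le_ereal_inf_tmp => _ [f _ <-]; exact: energy_ge0.
Qed.

(* The conductances [c_i = 1 / Cap (om i, om i.+1)] add up along the chain; the
   factor [th < 1] makes up for the infima not being attained. *)
Lemma chain_energy (th : R) m i : (0 < th < 1)%R ->
  (0 < \sum_(i <= j < i + m) th * c j)%R ->
  exists f : M -> R, [/\ C1 f,
    forall x, (\1_(om i) x <= f x <= \1_(om (i + m)%N) x)%R &
    energy nu f <= (\sum_(i <= j < i + m) th * c j)^-1%:E].
Proof.
move=> /andP[th0 th1]; elim: m i => [|m IH] i.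
  by rewrite addn0 big_geq// ltxx.
rewrite big_ltn ?addnS ?ltnS ?leq_addr//.
set D := (\sum_(_ <= _ < _) _)%R => cD.
have D0 : (0 <= D)%R by apply: sumr_ge0 => j _; rewrite mulr_ge0 ?(ltW th0).
have homom j k : (j <= k)%N -> om j `<=` om k.
  elim: k => [|k IHk]; first by rewrite leqn0 => /eqP->.
  by rewrite leq_eqVlt => /predU1P[-> //|jk] x /(IHk jk); exact: omS.
have tail : (0 < D)%R -> exists f : M -> R, [/\ C1 f,
    forall x, (\1_(om i.+1) x <= f x <= \1_(om (i + m).+1) x)%R &
    energy nu f <= (D^-1)%:E].
  by move=> D1; apply: (IH i.+1).
(* If [c_i = 0], the function built for the tail is enough: it is 1 on [om i.+1], hence on
   [om i]. *)
have [ci0|ci] := leP (c i) 0%R.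
  have c0 : c i = 0%R by apply/eqP; rewrite eq_le ci0 c_ge0.
  rewrite c0 mulr0 add0r in cD *.
  have [f [f1 fO fE]] := tail cD; exists f; split => // x.
  have /andP[fl ->] := fO x; rewrite andbT; apply: le_trans fl.
  exact: indic_le.
have ai : (0 < a i)%R by move: ci; rewrite /c; case: ifP => //; rewrite ltxx.
have head : exists f : M -> R, [/\ C1 f,
    forall x, (\1_(om i) x <= f x <= \1_(om i.+1) x)%R &
    energy nu f <= ((th * c i)^-1)%:E].
  have cap0 := capacity_gt0 (mom i) (mom i.+1) (omle i.+1) ai.
  (* As [th < 1], [1 / (th c_i)] exceeds the capacity, so a competitor lies below it. An infinite
     capacity is excluded by [c_i > 0]. *)
  have : capacity nu (om i) (om i.+1) < ((th * c i)^-1)%:E.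
    move: ci cap0; rewrite /c ai.
    case: (capacity nu (om i) (om i.+1)) => [r|/=|//]; last by rewrite ltxx.
    rewrite inver; case: eqVneq => [->|rN0 /=]; first by rewrite ltxx.
    rewrite invr_gt0 !lte_fin => r0 _; rewrite invfM invrK.
    by rewrite ltr_pMl// invf_gt1.
  move=> /ereal_inf_lt[_ [f [f1 fO] <-] fE].
  by exists f; split => //; exact: ltW.
have [f0 [f01 f0O f0E]] := head.
have [D1|D1] := ltP 0%R D; last first.
  have DE : D = 0%R by apply/eqP; rewrite eq_le D1 D0.
  exists f0; split => //; last by rewrite DE addr0.
  move=> x; have /andP[-> /=] := f0O x; move=> /le_trans; apply.
  by apply: indic_le; apply: homom; rewrite ltnS leq_addr.
have [g [g1 gO gE]] := tail D1.
set C := (th * c i)%R in cD f0E *.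
have C0 : (0 < C)%R by rewrite mulr_gt0.
have CD0 : (0 < C + D)%R by rewrite addr_gt0.
(* These weights minimize [w^2 / C + (1 - w)^2 / D], whose minimum is [1 / (C + D)]. *)
have w1 : (C / (C + D) + D / (C + D) = 1)%R by rewrite -mulrDl mulfV ?gt_eqF.
have im : (i.+1 <= (i + m).+1)%N by rewrite ltnS leq_addr.
have [h [h1 hO hE]] := energy_chain nu (mom i.+1) f01 g1
  (ltW (divr_gt0 C0 CD0)) (ltW (divr_gt0 D1 CD0))
  w1 (@omS i) (homom _ _ im) f0O gO.
exists h; split => //; apply: (le_trans hE).
apply: (@le_trans _ _ (((C / (C + D)) ^+ 2)%:E * (C^-1)%:E +
    ((D / (C + D)) ^+ 2)%:E * (D^-1)%:E)).
  by apply: leeD; apply: lee_wpmul2l => //; rewrite lee_fin sqr_ge0.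
rewrite -!EFinM -EFinD lee_fin le_eqVlt; apply/orP; left; apply/eqP.
by field; rewrite !gt_eqF.
Qed.

(** If this failed, some [th < 1] would still satisfy [th a_i S > 4 beta], and the function of
    [chain_energy] from [om i] to [om N] would contradict [energy_ge_measure]. *)
Lemma chain_conductance i N : (i <= N)%N -> (0 < a i)%R ->
  (a i * \sum_(i <= j < N) c j <= 4 * beta (a i / 4))%R.
Proof.
move=> iN ai; have b0 := beta_ge0 (divr_gt0 ai (ltr0Sn R 3)).
rewrite leNgt; apply/negP => lt.
set S := (\sum_(i <= j < N) c j)%R in lt *.
have aS0 : (0 < a i * S)%R by apply: le_lt_trans lt; rewrite mulr_ge0.
have S0 : (0 < S)%R by move: aS0; rewrite pmulr_rgt0.
(* Makes [th a_i S] the midpoint of [4 beta] and [a_i S]. *)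
pose th : R := ((4 * beta (a i / 4) + a i * S) / (2 * (a i * S)))%R.
have th01 : (0 < th < 1)%R.
  have num0 : (0 < 4 * beta (a i / 4) + a i * S)%R by rewrite ltr_wpDl// mulr_ge0.
  have den0 : (0 < 2 * (a i * S))%R by rewrite mulr_gt0.
  rewrite /th divr_gt0//=.
  by rewrite ltr_pdivrMr ?mulr_gt0// mul1r; lra.
have sumE : (\sum_(i <= j < i + (N - i)) th * c j = th * S)%R.
  by rewrite subnKC// -mulr_sumr.
have thE : (th * (a i * S) = (4 * beta (a i / 4) + a i * S) / 2)%R.
  rewrite /th; move: (a i * S)%R aS0 => X X0; field; exact: lt0r_neq0.
clearbody th; have /andP[th0 th1] := th01.
have [] := @chain_energy th (N - i) i th01; first by rewrite sumE mulr_gt0.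
rewrite sumE => f [f1 fO fE].
have fO' x : (\1_(om i) x <= f x <= \1_Omega x)%R.
  have /andP[-> /=] := fO x; move/le_trans; apply.
  exact: indic_le.
have : (a i / 4)%:E <= (beta (a i / 4))%:E * ((th * S)^-1)%:E.
  apply: (le_trans (energy_ge_measure wp (mom i) mOmega muOmega f1 fO' ai)).
  by rewrite lee_wpmul2l// lee_fin.
rewrite -EFinM lee_fin ler_pdivlMr ?mulr_gt0// => h.
move: h thE; rewrite -/(a i); set b := beta _; nra.
Qed.

(** Carries [chain_sum_le] over to the extended reals: a null set and an infinite capacity both give
    a zero term, and every other capacity is a positive real. *)
Lemma chain_sum (J : R -> R) (p : R) N : (1 <= p)%R ->
  (forall x y : R, (0 <= x)%R -> (x <= y)%R -> (0 < y)%R -> (y <= 2^-1)%R ->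
    (J x + (y - x) * beta (y / 4) `^ p <= J y)%R) ->
  \sum_(0 <= i < N) (mu (om i) `^ (1 + p) / capacity nu (om i) (om i.+1) `^ p) <=
  ((1 + p) * 4 `^ p * (J 2^-1 - J 0))%:E.
Proof.
move=> p1 J_incr; have p0 : (0 < p)%R := lt_le_trans ltr01 p1.
have P0 : (0 < 1 + p)%R := addr_gt0 ltr01 p0.
have := @chain_sum_le _ beta J p p1 beta_ge0 J_incr a c N.
move=> /(_ (fun i => introT andP (conj (a_ge0 i) (a_le i))) aS c_ge0
  (fun i => @chain_conductance i N)).
rewrite -lee_fin; apply: le_trans; rewrite -sumEFin le_eqVlt; apply/orP; left.
apply/eqP; apply: eq_bigr => i _; rewrite aE poweR_EFin.
have [ai|ai] := ltP 0%R (a i); last first.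
  have -> : a i = 0%R by apply/eqP; rewrite eq_le ai a_ge0.
  by rewrite powR0 ?gt_eqF// mul0e mul0r.
have := capacity_gt0 (mom i) (mom i.+1) (omle i.+1) ai.
rewrite /c ai; case: (capacity nu _ _) => [r r0|_|//].
- have rp : (0 < r `^ p)%R by rewrite powR_gt0.
  rewrite poweR_EFin !inver !gt_eqF//= -EFinM; congr (_ * _)%:E.
  apply: (mulIf (lt0r_neq0 rp)); rewrite mulVf ?gt_eqF// -powRM ?invr_ge0 ?ltW//.
  by rewrite mulVf ?gt_eqF// powR1.
- by rewrite poweRyr ?gt_eqF// invey mule0/= powR0 ?gt_eqF// mulr0.
Qed.
End chains.

(** * Lower bound on the constant [kappa_P] *)

Section kappa.
Context (R : realType) (q : R).
Local Open Scope ring_scope.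
Hypothesis q12 : 2^-1 <= q < 1.

(** The assumption [q >= 1/2] enters twice: as [2 q >= 1], so that [rho^(2q) <= rho], and as
    [r = 1/q - 1 <= 1]. *)
Lemma kappa_P_ge : 4 <= kappa_P q * 4 `^ ((1 - q) / q).
Proof.
have /andP[q2 q1] := q12.
have q0 : 0 < q by apply: lt_le_trans q2; rewrite invr_gt0.
set r := (1 - q) / q.
have qr : q^-1 = 1 + r by rewrite /r; field; rewrite gt_eqF.
have r0 : 0 <= r by rewrite divr_ge0 ?subr_ge0 ?ltW.
have r1 : r <= 1 by rewrite ler_pdivrMr//; lra.
(* The factor [8^(-r)] is there to cancel [2^r 4^r]. *)
have lb : 4 * 8 `^ (- r) <= inf [set (1 - rho `^ (2 * q)) `^ q^-1 /
    (rho ^+ 2 * (1 - rho) ^+ 2) | rho in [set rho | 0 < rho < 1]].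
  apply: lb_le_inf.
    exists ((1 - 2^-1 `^ (2 * q)) `^ q^-1 / (2^-1 ^+ 2 * (1 - 2^-1) ^+ 2)), 2^-1 => //=.
    by rewrite invr_gt0 invf_lt1 ?ltr1n ?ltr0n.
  move=> _ [rho /andP[rho0 rho1] <-].
  have s0 : 0 < 1 - rho by rewrite subr_gt0.
  have rho_le : rho `^ (2 * q) <= rho.
    by apply: ge1r_powR; [rewrite rho0 ltW|lra].
  set s := 1 - rho in s0 *.
  have rs0 : 0 < rho * s by rewrite mulr_gt0.
  rewrite -exprMn ler_pdivlMr ?exprn_gt0//.
  apply: (@le_trans _ _ (s `^ q^-1)); last first.
    apply: ge0_ler_powR; rewrite ?nnegrE ?invr_ge0 ?(ltW s0) ?(ltW q0)//.
      by rewrite subr_ge0; exact: le_trans rho_le (ltW rho1).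
    by rewrite /s lerD2l lerN2.
  (* The exponent 2 is split as [(1 - r) + (1 + r)] with [1 + r = 1/q]. The first factor is bounded
     by [rho s <= 1/4], the second by [s^(1/q)]. *)
  have -> : (rho * s) ^+ 2 = (rho * s) `^ (1 - r) * (rho * s) `^ q^-1.
    rewrite -powRD; last by rewrite (gt_eqF rs0) implybT.
    by rewrite qr -powR_mulrn ?ltW//; congr (_ `^ _); ring.
  have h1 : (rho * s) `^ (1 - r) <= 4^-1 `^ (1 - r).
    apply: ge0_ler_powR; rewrite ?nnegrE ?(ltW rs0) ?subr_ge0 ?invr_ge0//.
    have := sqr_ge0 (rho - 2^-1); rewrite /s; lra.
  have h2 : (rho * s) `^ q^-1 <= s `^ q^-1.
    apply: ge0_ler_powR; rewrite ?nnegrE ?(ltW rs0) ?(ltW s0) ?invr_ge0 ?(ltW q0)//.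
    by rewrite ger_pMl// ltW.
  rewrite mulrA -[leRHS]mul1r ler_pM ?mulr_ge0 ?powR_ge0//.
  have e4 : 4 = 2 `^ 2 :> R by rewrite -[2 in RHS]/(2%:R) powR_mulrn//; ring.
  have e8 : 8 = 2 `^ 3 :> R by rewrite -[3 in RHS]/(3%:R) powR_mulrn//; ring.
  apply: (@le_trans _ _ (4 * 8 `^ (- r) * 4^-1 `^ (1 - r))).
    by rewrite ler_wpM2l// mulr_ge0// powR_ge0.
  rewrite -powR_inv1// e4 e8 -!powRrM -!powRD ?pnatr_eq0 ?implybT//.
  by rewrite -[leRHS](powRr0 2) ler_powR ?ler1n//; lra.
rewrite /kappa_P -/r.
apply: (@le_trans _ _ (2 `^ r * (4 * 8 `^ (- r)) * 4 `^ r)).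
  have -> : (8 : R) = 2 * 4 by ring.
  rewrite powRN powRM// le_eqVlt; apply/orP; left; apply/eqP.
  by field; rewrite !gt_eqF// powR_gt0.
by rewrite ler_wpM2r ?powR_ge0// ler_wpM2l ?powR_ge0.
Qed.
End kappa.

(** * The bound on [beta_P] *)

Section beta_P_bound.
Context (R : realType) (n : nat) (M : riemannianManifold R n).
Variables (mu : probability (borel M) R) (nu : {measure set (borel M) -> \bar R}).

(** A finite set of integers lies in some [[-N, N]], which [i - N] enumerates for [i] from 0 to
    [2 N]. *)
Lemma esum_int_le (t : int -> \bar R) (B : \bar R) : (forall k, 0 <= t k) ->
  (forall N m, \sum_(0 <= i < m) t (i%:Z - N%:Z)%R <= B) ->
  \esum_(k in [set: int]) t k <= B.
Proof.
move=> t0 tB; apply: ge_ereal_sup => _ [F [finF _] <-].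
have [s Fs] := iffLR (finite_seqP F) finF.
pose N := (\max_(k <- s) `|k|)%N.
have kN k : F k -> (`|k| <= N)%N.
  by rewrite Fs => ks; exact: (@leq_bigmax_seq _ _ xpredT absz).
pose h (i : nat) : int := (i%:Z - N%:Z)%R.
have hinj : injective h by move=> i j /addIr [].
apply: (@le_trans _ _ (\sum_(k \in h @` `I_(2 * N).+1) t k)).
  apply: lee_fsum_nneg_subset => //; first exact: finite_image.
  move=> k; rewrite !inE => /kN; clear; move: k N @h => /= k N kN.
  by exists (absz (k + N%:Z)%R); lia.
rewrite fsbig_image; last by move=> i j _ _; exact: hinj.
rewrite -(fsbig_ord _ _ (fun i => t (h i))).
by rewrite -(big_mkord xpredT (fun i => t (h i))); exact: tB.
Qed.

Lemma beta_P_le (q : R) (beta : R -> R) : (2^-1 <= q < 1)%R ->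
  weak_poincare mu nu beta ->
  \int[lebesgue_measure]_(t in `]0%R, (2^-1)%R])
    (beta (t / 4) `^ (q / (1 - q)))%:E < +oo ->
  beta_P mu nu q <=
    (kappa_P q)%:E * ((4 / (1 - q)) `^ ((1 - q) / q))%:E *
    (\int[lebesgue_measure]_(t in `]0%R, (2^-1)%R])
       (beta (t / 4) `^ (q / (1 - q)))%:E) `^ ((1 - q) / q).
Proof.
move=> q12 wp; have /andP[q2 q1] := q12; set p := (q / (1 - q))%R => Ioo.
have q0 : (0 < q)%R by apply: lt_le_trans q2; rewrite invr_gt0.
have oq0 : (0 < 1 - q)%R by rewrite subr_gt0.
have p1 : (1 <= p)%R by rewrite ler_pdivlMr// mul1r; lra.
have p0 : (0 < p)%R := lt_le_trans ltr01 p1.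
have [b0 bn _] := wp.
have [J [J0 J2 J_incr]] := profile_primitive b0 bn (ltW p0) Ioo.
rewrite -J2 poweR_EFin -!EFinM.
set r := ((1 - q) / q)%R.
have rp : (r = p^-1)%R by rewrite /r /p; field; rewrite !gt_eqF.
have r0 : (0 < r)%R by rewrite rp invr_gt0.
have P1 : ((1 - q)^-1 = 1 + p)%R by rewrite /p; field; rewrite gt_eqF.
have Jge : (0 <= J 2^-1)%R.
  by rewrite -J0; apply: (J_homo J_incr); rewrite ?invr_ge0.
apply: ge_ereal_sup => _ [Om [om [mO muO mom omS ->]]].
have sumle : \esum_(k in [set: int])
    (mu (om k) `^ (1 - q)^-1 / capacity nu (om k) (om (k + 1)%R) `^ p) <=
    ((1 + p) * 4 `^ p * J 2^-1)%:E.
  apply: esum_int_le => [k|N m].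
    rewrite mule_ge0 ?poweR_ge0// inve_ge0 poweR_ge0//.
  rewrite P1; have -> : (J 2^-1 = J 2^-1 - J 0)%R by rewrite J0 subr0.
  pose omN (i : nat) := om (i%:Z - N%:Z)%R.
  have omNS i : omN i.+1 = om (i%:Z - N%:Z + 1)%R.
    by rewrite /omN intS; congr om; ring.
  apply: le_trans (chain_sum wp (om := omN) mO muO _ _ _ m p1 J_incr).
  - by apply: lee_sum => i _; rewrite omNS.
  - by move=> i; exact: mom.
  - by move=> i; rewrite omNS; have [] := omS (i%:Z - N%:Z)%R.
  - by move=> i; have [/subset_trans] := omS (i%:Z - N%:Z)%R; apply.
apply: (le_trans (gt0_ler_poweR (ltW r0) _ _ sumle)).
- rewrite in_itv/= esum_ge0 ?leey// => k _.
  by rewrite mule_ge0 ?poweR_ge0// inve_ge0 poweR_ge0.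
- by rewrite in_itv/= leey andbT lee_fin !mulr_ge0 ?powR_ge0// addr_ge0// ltW.
rewrite poweR_EFin lee_fin.
have P0 : (0 <= 1 + p)%R by rewrite addr_ge0// ltW.
(* As [1 + p = 1/(1-q)] and [r = 1/p], the left side is [4 (1+p)^r J(1/2)^r] and the right side
   [kappa_P 4^r (1+p)^r J(1/2)^r]. *)
rewrite !powRM ?mulr_ge0 ?powR_ge0 ?invr_ge0 ?(ltW oq0)//.
rewrite P1 -powRrM rp mulfV ?gt_eqF// powRr1// -rp.
have := kappa_P_ge q12; rewrite -/r => k4.
rewrite ler_wpM2r ?powR_ge0// mulrA mulrC ler_wpM2r ?powR_ge0//.
Qed.
End beta_P_bound.

(** * Existence of a median *)

Section median.
Context d (T : measurableType d) (R : realType) (P : probability T R).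

Lemma probability_bigcup_le (F : nat -> set T) (c : \bar R) :
  (forall i, measurable (F i)) -> nondecreasing_seq F ->
  (forall i, P (F i) <= c) -> P (\bigcup_i F i) <= c.
Proof.
move=> mF ndF Fc.
have cF := nondecreasing_cvg_mu (mu := P) mF (bigcup_measurable (fun i _ => mF i)) ndF.
rewrite -(cvg_lim _ cF)//; apply: lime_le; first by apply/cvg_ex; eexists; exact: cF.
exact: nearW.
Qed.

(** The median is the infimum of the set [S] of all [r] with [P(f > r) <= 1/2]. [S] is nonempty,
    since otherwise the sets [f <= i], which exhaust the space, would all have mass at most 1/2.
    Both bounds at [inf S] follow by continuity from below. *)
Lemma exists_median (f : T -> R) : measurable_fun [set: T] f ->
  (forall x, 0 <= f x)%R ->
  exists m : R, [/\ (0 <= m)%R, P [set x | (m < f x)%R] <= (2^-1)%:E &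
    P [set x | (f x < m)%R] <= (2^-1)%:E].
Proof.
move=> mf f0.
have mgt r : measurable [set x | (r < f x)%R].
  rewrite (_ : [set x | _] = f @^-1` `]r, +oo[).
    by rewrite -[X in measurable X]setTI; exact: mf.
  by apply/seteqP; split=> x /=; rewrite in_itv/= andbT.
have mle r : measurable [set x | (f x <= r)%R].
  rewrite (_ : [set x | _] = f @^-1` `]-oo, r]).
    by rewrite -[X in measurable X]setTI; exact: mf.
  by apply/seteqP; split=> x /=; rewrite in_itv/=.
have leC r : [set x | (f x <= r)%R] = ~` [set x | (r < f x)%R].
  by apply/seteqP; split=> x /=; rewrite leNgt => /negP.
pose S := [set r | P [set x | (r < f x)%R] <= (2^-1)%:E].
have notS r : ~ S r -> P [set x | (f x <= r)%R] <= (2^-1)%:E.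
  move/negP; rewrite -ltNge leC probability_setC//.
  have [a aE] : exists a, P [set x | (r < f x)%R] = a%:E.
    by exists (fine (P [set x | (r < f x)%R])); rewrite fineK// fin_num_measure.
  by rewrite aE -EFinB lte_fin lee_fin; lra.
have arch (r : R) : exists k : nat, (r <= k%:R)%R.
  by exists (Num.bound `|r|%R); apply: (le_trans (ler_norm _)); exact/ltW/archi_boundP.
have S0 : S !=set0.
  apply: contrapT => /set0P/negP/negPn/eqP SE.
  have : P [set: T] <= (2^-1)%:E.
    rewrite (_ : [set: T] = \bigcup_i [set x | (f x <= i%:R)%R]).
      apply: probability_bigcup_le => // [i j ij|i].
        by apply/subsetPset => x /= /le_trans; apply; rewrite ler_nat.
      by apply: notS; rewrite SE.
    by apply/seteqP; split=> // x _; have [k fk] := arch (f x); exists k.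
  by rewrite probability_setT lee_fin; lra.
have Slb r : S r -> (0 <= r)%R.
  apply: contraPP => /negP; rewrite -ltNge => r0; rewrite /S/=.
  rewrite (_ : [set x | _] = [set: T]).
    by rewrite probability_setT lee_fin; apply/negP; rewrite -ltNge; lra.
  by apply/seteqP; split => // x _ /=; exact: lt_le_trans r0 (f0 x).
have hS : has_inf S by split => //; exists 0%R.
exists (inf S); split.
- exact: lb_le_inf.
- rewrite (_ : [set x | _] = \bigcup_i [set x | (inf S + i.+1%:R^-1 < f x)%R]).
    apply: probability_bigcup_le => // [i j ij|i].
      apply/subsetPset => x /=; apply: le_lt_trans.
      by rewrite lerD2l lef_pV2 ?posrE// ler_nat.
    have i0 : (0 < i.+1%:R^-1 :> R)%R by rewrite invr_gt0.
    have [s Ss si] := inf_adherent i0 hS.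
    apply: le_trans Ss; apply: le_measure; rewrite ?inE// => x /=.
    exact: lt_trans.
  apply/seteqP; split=> x /=.
    move=> mx; have [k kP] := arch ((f x - inf S)^-1)%R; exists k => //=.
    rewrite -ltrBrDl invf_plt ?posrE ?subr_gt0//.
    by rewrite (le_lt_trans kP)// ltr_nat.
  by move=> [i _] /=; apply: lt_trans; rewrite ltrDl invr_gt0.
- rewrite (_ : [set x | _] = \bigcup_i [set x | (f x <= inf S - i.+1%:R^-1)%R]).
    apply: probability_bigcup_le => // [i j ij|i].
      apply/subsetPset => x /= /le_trans; apply.
      by rewrite lerD2l lerN2 lef_pV2 ?posrE// ler_nat.
    apply: notS => /(ge_inf (proj2 hS)); apply/negP; rewrite -ltNge.
    by rewrite ltrBlDr ltrDl invr_gt0.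
  apply/seteqP; split=> x /=.
    move=> mx; have [k kP] := arch ((inf S - f x)^-1)%R; exists k => //=.
    rewrite lerBrDl -lerBrDr invf_ple ?posrE ?subr_gt0//.
    by rewrite (le_trans kP)// ler_nat.
  by move=> [i _] /= /le_lt_trans; apply; rewrite ltrBlDr ltrDl invr_gt0.
Qed.
End median.

(** * Real sums over dyadic levels *)

Section level_sums.
Context (R : realType) (beta J : R -> R) (q : R).
Local Open Scope ring_scope.
Hypothesis q0 : 0 < q.
Hypothesis q1 : q < 1.
Hypothesis beta_ge0 : forall s : R, 0 < s -> 0 <= beta s.
Hypothesis J_incr : forall a b : R, 0 <= a -> a <= b -> 0 < b -> b <= 2^-1 ->
    J a + (b - a) * beta (b / 4) `^ (q / (1 - q)) <= J b.

Let q1q : q + (1 - q) = 1.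
Proof. by rewrite addrC subrK. Qed.

(** Superadditivity of the power [1/q >= 1], applied to [x^q] and [(y - x)^q]. *)
Lemma powR_subadd (x y : R) : 0 <= x -> x <= y -> y `^ q - x `^ q <= (y - x) `^ q.
Proof.
move=> x0 xy; have q1' : 1 <= q^-1 by rewrite invf_ge1// ltW.
have yx0 : 0 <= y - x by rewrite subr_ge0.
have := powR_superadd q1' (powR_ge0 x q) (powR_ge0 (y - x) q).
rewrite -!powRrM mulfV ?gt_eqF// !powRr1// addrC subrK => h.
rewrite lerBlDl -[leRHS]powRr1 ?addr_ge0 ?powR_ge0// -(mulVf (lt0r_neq0 q0)) powRrM.
by apply: ge0_ler_powR; rewrite ?nnegrE ?powR_ge0 ?(ltW q0)// (le_trans x0).
Qed.

Lemma powR_young (x y : R) : 0 <= x -> 0 <= y -> x `^ q * y `^ (1 - q) <= x + y.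
Proof.
move=> x0 y0; have xy0 : 0 <= x + y by rewrite addr_ge0.
have q1' : 0 < 1 - q by rewrite subr_gt0.
apply: (@le_trans _ _ ((x + y) `^ q * (x + y) `^ (1 - q))).
  by rewrite ler_pM ?powR_ge0//; apply: ge0_ler_powR;
    rewrite ?nnegrE ?lerDl ?lerDr ?(ltW q0) ?(ltW q1').
by rewrite -powRD ?q1q ?powRr1// oner_eq0.
Qed.

(** With [d = a - a'], the interpolation [d <= a^q d^(1-q)] leaves [(l^2 a)^q], controlled by the
    energy, times [d^(1-q)], which takes up [beta^q] and becomes an increment of [J]. Dividing [E]
    by [e] keeps the energy parts summable to at most 1. *)
Lemma level_term_le (l a a' E e : R) : 0 < l -> 0 <= a' -> a' <= a -> a <= 2^-1 ->
  0 <= E -> 0 < e -> (0 < a -> l ^+ 2 * a <= 64 * beta (a / 4) * E) ->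
  (2 * l) `^ (2 * q) * (a - a') <= 256 `^ q * e `^ q * (E / e + (J a - J a')).
Proof.
move=> l0 a'0 a'a a2 E0 e0 laE.
have [ai|ai] := ltP 0 a; last first.
  have aE : a = 0 by apply/eqP; rewrite eq_le ai (le_trans a'0).
  have a'E : a' = 0 by apply/eqP; rewrite eq_le a'0 -aE a'a.
  by rewrite aE a'E !subrr mulr0 addr0 !mulr_ge0 ?powR_ge0 ?invr_ge0 ?(ltW e0).
have {}laE := laE ai.
have b0 : 0 <= beta (a / 4) by rewrite beta_ge0// divr_gt0.
set b := beta (a / 4) in laE b0.
have q1' : 0 < 1 - q by rewrite subr_gt0.
have d0 : 0 <= a - a' by rewrite subr_ge0.
have da : a - a' <= a by rewrite gerBl.
have Jd : (a - a') * b `^ (q / (1 - q)) <= J a - J a'.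
  by rewrite lerBrDl; exact: J_incr.
set d := a - a' in d0 da Jd *.
have aq0 : 0 < a `^ q by rewrite powR_gt0.
(* 256 is 64 times the 4 of [(2 l)^2]. *)
have h1 : (2 * l) `^ (2 * q) * a `^ q <= (256 * b * E) `^ q.
  rewrite powRrM -powRM ?powR_ge0 ?(ltW ai)//.
  apply: ge0_ler_powR; rewrite ?nnegrE ?mulr_ge0 ?powR_ge0 ?(ltW q0) ?(ltW ai)//.
  have -> : (2 * l) `^ 2 = (2 * l) ^+ 2 by rewrite -powR_mulrn// mulr_ge0// ltW.
  rewrite exprMn; lra.
have h2 : d <= a `^ q * d `^ (1 - q).
  have {1}-> : d = d `^ q * d `^ (1 - q).
    by rewrite -powRD ?q1q ?powRr1// oner_eq0.
  by rewrite ler_wpM2r ?powR_ge0//; apply: ge0_ler_powR;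
    rewrite ?nnegrE ?(ltW q0) ?(ltW ai).
apply: (@le_trans _ _ ((2 * l) `^ (2 * q) * (a `^ q * d `^ (1 - q)))).
  by rewrite ler_wpM2l ?powR_ge0.
rewrite mulrA; apply: (@le_trans _ _ ((256 * b * E) `^ q * d `^ (1 - q))).
  by rewrite ler_wpM2r ?powR_ge0.
have Ee : 0 <= E / e by rewrite divr_ge0// ltW.
(* Uses [b^q = (b^(q/(1-q)))^(1-q)]. *)
have -> : (256 * b * E) `^ q * d `^ (1 - q) =
    256 `^ q * e `^ q * ((E / e) `^ q * (d * b `^ (q / (1 - q))) `^ (1 - q)).
  rewrite [X in _ = _ * (_ * X)]powRM ?powR_ge0// -powRrM divfK ?gt_eqF//.
  rewrite !powRM ?mulr_ge0 ?invr_ge0 ?(ltW e0)//.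
  have : e `^ q * e^-1 `^ q = 1.
    by rewrite -powRM ?invr_ge0 ?(ltW e0)// mulfV ?gt_eqF// powR1.
  move: (256 `^ q) (b `^ q) (E `^ q) (d `^ _) (e `^ q) (e^-1 `^ q) => A B C D G H GH.
  by rewrite -[LHS]mulr1 -GH; ring.
rewrite ler_wpM2l ?mulr_ge0 ?powR_ge0//.
apply: le_trans (powR_young Ee _) _; first by rewrite mulr_ge0 ?powR_ge0.
by rewrite lerD2l.
Qed.

Lemma level_sum_le (l a E : nat -> R) (e : R) N : (forall j, 0 < l j) ->
  (forall j, 0 <= a j <= 2^-1) -> (forall j, a j.+1 <= a j) ->
  (forall j, 0 <= E j) -> 0 < e -> \sum_(0 <= j < N) E j <= e ->
  (forall j, 0 < a j -> l j ^+ 2 * a j <= 64 * beta (a j / 4) * E j) ->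
  \sum_(0 <= j < N) (2 * l j) `^ (2 * q) * (a j - a j.+1) <=
  256 `^ q * e `^ q * (1 + (J 2^-1 - J 0)).
Proof.
move=> l0 a01 aS E0 e0 Ee laE.
apply: (@le_trans _ _ (\sum_(0 <= j < N)
    256 `^ q * e `^ q * (E j / e + (J (a j) - J (a j.+1))))).
  apply: ler_sum => j _; have /andP[? ?] := a01 j; have /andP[? ?] := a01 j.+1.
  by apply: level_term_le => //; exact: laE.
rewrite -mulr_sumr ler_wpM2l ?mulr_ge0 ?powR_ge0// big_split/=; apply: lerD.
  by rewrite -mulr_suml ler_pdivrMr// mul1r.
have -> : \sum_(0 <= j < N) (J (a j) - J (a j.+1)) = J (a 0%N) - J (a N).
  elim: N {Ee} => [|N IH]; first by rewrite big_geq// subrr.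
  by rewrite big_nat_recr//= IH; ring.
have /andP[? ?] := a01 0%N; have /andP[? ?] := a01 N.
by apply: lerB; apply: (J_homo J_incr).
Qed.
End level_sums.

(** * Truncation of a function between dyadic levels *)

Section levels.
Context (R : realType) (n : nat) (M : riemannianManifold R n).
Variables (mu : probability (borel M) R) (nu : {measure set (borel M) -> \bar R}).
Variables (beta J : R -> R) (q : R).
Hypothesis wp : weak_poincare mu nu beta.
Hypothesis q0 : (0 < q)%R.
Hypothesis q1 : (q < 1)%R.
Hypothesis J_incr : forall a b : R, (0 <= a)%R -> (a <= b)%R -> (0 < b)%R ->
  (b <= 2^-1)%R -> (J a + (b - a) * beta (b / 4) `^ (q / (1 - q)) <= J b)%R.

Variables (h : M -> R) (e : R).
Hypothesis h1 : C1 h.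
Hypothesis mu_pos : mu [set x | (0 < h x)%R] <= (2^-1)%:E.
Hypothesis e0 : (0 < e)%R.
Hypothesis he : energy nu h <= e%:E.

Let beta_ge0 (s : R) : (0 < s)%R -> (0 <= beta s)%R.
Proof. by have [+ _ _] := wp; apply. Qed.

Let mh : measurable_fun [set: borel M] (h : borel M -> R) := C1_measurable h1.

Let mge r : measurable ([set x | (r <= h x)%R] : set (borel M)).
Proof.
rewrite (_ : [set x | _] = (h : borel M -> R) @^-1` `[r, +oo[).
  by rewrite -[X in measurable X]setTI; exact: mh.
by apply/seteqP; split=> x /=; rewrite in_itv/= andbT.
Qed.

Let mlt r : measurable ([set x | (h x < r)%R] : set (borel M)).
Proof.
rewrite (_ : [set x | _] = ~` [set x | (r <= h x)%R]).
  exact: measurableC.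
by apply/seteqP; split=> x /=; rewrite ltNge => /negP.
Qed.

Let mgt : measurable ([set x | (0 < h x)%R] : set (borel M)).
Proof.
rewrite (_ : [set x | _] = (h : borel M -> R) @^-1` `]0%R, +oo[).
  by rewrite -[X in measurable X]setTI; exact: mh.
by apply/seteqP; split=> x /=; rewrite in_itv/= andbT.
Qed.

(** Half-open, so that consecutive dyadic bands are disjoint. *)
Let band (r s : R) : set (borel M) := [set x | (r <= h x)%R] `&` [set x | (h x < s)%R].

Let mband r s : measurable (band r s).
Proof. exact: measurableI. Qed.

Let sq0 x : 0 <= (sqnorm_gradient h x)%:E.
Proof. by rewrite lee_fin sqnorm_gradient_ge0. Qed.

Let E (l : R) : R := fine (\int[nu]_(x in band (l / 2) l) (sqnorm_gradient h x)%:E).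

Let EE l : (E l)%:E = \int[nu]_(x in band (l / 2) l) (sqnorm_gradient h x)%:E.
Proof.
rewrite fineK// ge0_fin_numE ?integral_ge0//; apply: (@le_lt_trans _ _ e%:E).
  apply: le_trans he; exact: ge0_integral_subset.
exact: ltry.
Qed.

Lemma level_measure_le (l : R) : (0 < l)%R -> let a := fine (mu [set x | (l <= h x)%R]) in
  (0 < a)%R -> (l ^+ 2 * a <= 64 * beta (a / 4) * E l)%R.
Proof.
move=> l0 a a0; have c0 : (0 < 2 / l)%R by rewrite divr_gt0.
(* The argument of [step] is 0 at [h = l/2] and 1 at [h = l], so the gradient of [g] lives on the
   band from [l/2] to [l]. *)
pose g := (fun r : R => step (2 / l * r - 1)) \o h.
have dE r := is_derive_step r c0.
have [g1 _] := C1_comp dE (@continuous_dstep _ _) h1.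
have gO x : (\1_[set x | (l <= h x)%R] x <= g x <= \1_[set x | (0 < h x)%R] x)%R.
  have /andP[s0 s1] := step_itv (2 / l * h x - 1)%R.
  rewrite !indicE /g/=; apply/andP; split.
    have [/[!inE]/= lh|_//] := boolP (x \in _).
    rewrite step_ge1// lerBrDr mulrAC ler_pdivlMr//; lra.
  have [_//|] := boolP (x \in _).
  rewrite notin_setE/= => /negP; rewrite -leNgt => hx0.
  rewrite step_le0// subr_le0 (le_trans (mulr_ge0_le0 (ltW c0) hx0))//.
have := energy_ge_measure wp (mge l) mgt mu_pos g1 gO a0.
have gE : energy nu g <= ((2 / l) ^+ 2 * 4 * E l)%:E.
  rewrite EFinM EE; apply: (energy_comp_le nu (mband _ _) dE) => //.
  - exact: continuous_dstep.
  - by move=> x; rewrite exprMn ler_wpM2l ?sqr_ge0 ?dstep_sqr_le.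
  - move=> x; rewrite /band/= => /not_andP nb; rewrite dstep_eq0 ?mulr0//.
    case: nb => /negP; rewrite -?ltNge -?leNgt => hl; [left|right].
      rewrite subr_le0 mulrAC ler_pdivrMr// mul1r.
      by move: hl; rewrite ltr_pdivlMr//; lra.
    by rewrite lerBrDr mulrAC ler_pdivlMr//; lra.
have b0 : (0 <= beta (a / 4))%R by rewrite beta_ge0// divr_gt0.
move=> aE; have : (a / 4)%:E <= (beta (a / 4))%:E * ((2 / l) ^+ 2 * 4 * E l)%:E.
  by apply: (le_trans aE); rewrite lee_wpmul2l.
rewrite -EFinM lee_fin => {}aE.
(* The squared slope [(2/l)^2] and [dstep^2 <= 4] give 16; the denominator of [a/4] raises it to
   64. *)
have := ler_wpM2l (sqr_ge0 l) aE.
have -> : (l ^+ 2 * (beta (a / 4) * ((2 / l) ^+ 2 * 4 * E l)) =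
    16 * (beta (a / 4) * E l))%R by field; rewrite gt_eqF.
lra.
Qed.

Let lam (dl : R) (j : nat) : R := (dl * 2 ^+ j)%R.

Let lamS dl j : lam dl j.+1 = (2 * lam dl j)%R.
Proof. by rewrite /lam exprS; ring. Qed.

Lemma level_energy_le (dl : R) N : (0 < dl)%R ->
  (\sum_(0 <= j < N) E (lam dl j) <= e)%R.
Proof.
(* The first [N] bands lie below [lam_(N-1) = lam_N / 2]; in this form the region grows by exactly
   one band at each step. *)
move=> dl0; rewrite -lee_fin; apply: (@le_trans _ _
    (\int[nu]_(x in [set x | (h x < lam dl N / 2)%R]) (sqnorm_gradient h x)%:E));
    last first.
  apply: le_trans he; exact: ge0_integral_subset.
rewrite -sumEFin; elim: N => [|N IH].
  by rewrite big_geq// integral_ge0.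
rewrite big_nat_recr//= EE (_ : [set x | (h x < lam dl N.+1 / 2)%R] =
    [set x | (h x < lam dl N / 2)%R] `|` band (lam dl N / 2) (lam dl N)).
  rewrite ge0_integral_disjointU//; first exact: leeD.
  apply/disj_setPS => x [/= hx [/= xh _]].
  by move: hx; rewrite ltNge xh.
have lN : (0 < lam dl N)%R by rewrite mulr_gt0// exprn_gt0.
have -> : (lam dl N.+1 / 2 = lam dl N)%R by rewrite lamS; field.
apply/seteqP; split=> x /=.
  by move=> hx; have [?|?] := ltP (h x) (lam dl N / 2)%R; [left|right].
by move=> [|[]//] hx; apply: (lt_le_trans hx); rewrite ler_pdivrMr//; lra.
Qed.

Let K : R := (256 `^ q * e `^ q * (1 + (J 2^-1 - J 0)))%R.

Let q2 : (0 < 2 * q)%R.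
Proof. by rewrite mulr_gt0. Qed.

Lemma level_integral_le (dl : R) : (0 < dl)%R ->
  \int[mu]_x (Num.max (h x) 0 `^ (2 * q))%:E <= (dl `^ (2 * q) + K)%:E.
Proof.
move=> dl0; have l0 j : (0 < lam dl j)%R by rewrite mulr_gt0// exprn_gt0.
pose a j := fine (mu [set x | (lam dl j <= h x)%R]).
have aE j : mu [set x | (lam dl j <= h x)%R] = (a j)%:E.
  by rewrite fineK// fin_num_measure.
have leS j : ([set x | (lam dl j.+1 <= h x)%R] `<=` [set x | (lam dl j <= h x)%R]).
  by move=> x /=; apply: le_trans; rewrite lamS; have := l0 j; lra.
(* On the layer where [h] is between [lam_j] and [lam_(j+1) = 2 lam_j], [w j] is the power [2 q] of
   the upper end. *)
pose w j x : \bar R := ((2 * lam dl j) `^ (2 * q))%:E *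
  (\1_([set x | (lam dl j <= h x)%R] `\` [set x | (lam dl j.+1 <= h x)%R]
    : set (borel M)) x)%:E.
have w0 j x : 0 <= w j x by rewrite mule_ge0// lee_fin ?powR_ge0.
have mD j : measurable (([set x | (lam dl j <= h x)%R] `\`
    [set x | (lam dl j.+1 <= h x)%R]) : set (borel M)) by exact: measurableD.
have mw j : measurable_fun [set: borel M] (w j).
  apply: emeasurable_funM; first exact: measurable_cst.
  by apply/measurable_EFinP; exact: measurable_indic.
have intw j : \int[mu]_x w j x = ((2 * lam dl j) `^ (2 * q) * (a j - a j.+1))%:E.
  rewrite ge0_integralZl//; last 2 first.
  - by apply/measurable_EFinP; exact: measurable_indic.
  - by rewrite lee_fin powR_ge0.
  rewrite integral_indic// setIT measureD//; last first.
    by rewrite -ge0_fin_numE// fin_num_measure.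
  rewrite (setIidr (leS j)). by rewrite EFinM EFinB -!aE.
apply: (@le_trans _ _ (\int[mu]_x ((dl `^ (2 * q))%:E + \sum_(j <oo) w j x))).
  apply: ge0_integral_le => x _; first by rewrite lee_fin powR_ge0.
  have [hx|hx] := ltP (h x) dl.
    rewrite -[leLHS]adde0 leeD//; last exact: nneseries_ge0.
    rewrite lee_fin; apply: ge0_ler_powR; rewrite ?nnegrE ?(ltW q2) ?(ltW dl0)//.
      by rewrite le_max lexx orbT.
    by rewrite ge_max (ltW hx) ltW.
  have ex : exists j, (h x < lam dl j.+1)%R.
    exists (Num.bound (h x / dl)%R).
    rewrite /lam mulrC -ltr_pdivrMr//.
    have hd0 : (0 <= h x / dl)%R by rewrite divr_ge0 ?(ltW dl0)// (le_trans (ltW dl0)).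
    apply: (lt_le_trans (archi_boundP hd0)).
    rewrite -natrX ler_nat ltnW// (ltn_trans (ltn_expl _ (ltnSn 1)))//.
    by rewrite ltn_exp2l.
  (* Minimality of [j] gives [lam_j <= h x]; for [j = 0] this is [dl <= h x]. *)
  have [j hj jmin] := ex_minnP ex.
  have jh : (lam dl j <= h x)%R.
    case: j hj jmin => [|j] hj jmin; first by rewrite /lam expr0 mulr1.
    rewrite leNgt; apply/negP => /jmin; by rewrite ltnn.
  rewrite -[leLHS]add0e leeD// ?lee_fin ?powR_ge0//.
  apply: (@le_trans _ _ (\sum_(0 <= i < j.+1) w i x)); last exact: nneseries_lim_ge.
  rewrite big_nat_recr//= -[leLHS]add0e leeD ?sume_ge0//.
  rewrite /w indicE mem_set ?mule1 ?lee_fin/=; last first.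
    by split => //=; apply/negP; rewrite -ltNge.
  have l20 : (0 <= 2 * lam dl j)%R by rewrite -lamS ltW.
  apply: ge0_ler_powR; rewrite ?nnegrE ?(ltW q2)//.
    by rewrite le_max lexx orbT.
  by rewrite ge_max -lamS (ltW hj) ltW.
rewrite ge0_integralD//; last 3 first.
- by move=> x _; rewrite lee_fin powR_ge0.
- by move=> x _; exact: nneseries_ge0.
- exact: ge0_emeasurable_sum.
rewrite integral_cst// [X in _ * X](probability_setT mu) mule1 EFinD leeD2l//.
rewrite integral_nneseries//; apply: lime_le.
  by apply: is_cvg_nneseries => k _ _; exact: integral_ge0.
apply: nearW => N; rewrite (eq_bigr _ (fun j _ => intw j)) sumEFin lee_fin.
apply: (@level_sum_le _ beta J q q0 q1 beta_ge0 J_incr (lam dl) a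
  (fun j => E (lam dl j))) => //.
- move=> j; rewrite fine_ge0//= -lee_fin -aE; apply: le_trans mu_pos.
  by apply: le_measure; rewrite ?inE// => x /=; apply: lt_le_trans.
- by move=> j; rewrite -lee_fin -!aE; apply: le_measure; rewrite ?inE.
- by move=> j; rewrite -lee_fin EE integral_ge0.
- exact: level_energy_le.
- by move=> j; exact: level_measure_le.
Qed.

(** The bound [K] does not depend on the lowest level [dl], which is sent to 0 with
    [dl^(2q) = eps]. *)
Lemma positive_part_integral_le :
  \int[mu]_x (Num.max (h x) 0 `^ (2 * q))%:E <= K%:E.
Proof.
apply/lee_addgt0Pr => eps eps0; pose dl := (eps `^ (2 * q)^-1)%R.
have := @level_integral_le dl; rewrite powR_gt0// => /(_ isT).
by rewrite EFinD addeC /dl -powRrM mulVf ?gt_eqF// (powRr1 (ltW eps0)).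
Qed.
End levels.

(** * The L^q-Poincare inequality, and the final theorem *)

Lemma variance_le_integral d (T : measurableType d) (R : realType)
    (P : probability T R) (X : T -> R) (c : R) : measurable_fun [set: T] X ->
  \int[P]_x ((X x - c) ^+ 2)%:E < +oo ->
  'V_P[X] <= \int[P]_x ((X x - c) ^+ 2)%:E.
Proof.
move=> mX Xoo; pose Y x := (X x - c)%R.
have mY : measurable_fun [set: T] Y by exact: measurable_funB.
have Y2 : Y \in Lfun P 2%:E by exact: Lfun2_of_sqr.
have XE : X = (Y \+ cst c)%R by apply/funext => x; rewrite /Y /= subrK.
rewrite {1}XE.
rewrite varianceD_cst_r// varianceE//.
have EY : 'E_P[Y] \is a fin_num.
  by rewrite expectation_fin_num// (Lfun_subset12 _ Y2)// fin_num_measure.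
have -> : 'E_P[Y ^+ 2] = \int[P]_x ((X x - c) ^+ 2)%:E by rewrite unlock.
by rewrite -(fineK EY) -EFin_expe leeBlDr// leeDl// lee_fin sqr_ge0.
Qed.

(** By symmetry [y <= x]; then this is the square of [powR_subadd]. *)
Lemma sqr_powR_sub_le (R : realType) (q x y : R) :
  (0 < q -> q < 1 -> 0 <= x -> 0 <= y ->
  (x `^ q - y `^ q) ^+ 2 <=
  Num.max (x - y) 0 `^ (2 * q) + Num.max (y - x) 0 `^ (2 * q))%R.
Proof.
move=> q0 q1.
have pw (z : R) : (z `^ (2 * q) = (z `^ q) ^+ 2)%R.
  by rewrite mulrC powRrM -powR_mulrn ?powR_ge0.
wlog yx : x y / (y <= x)%R => [th x0 y0|x0 y0].
  have [yx|xy] := leP y x; first exact: th.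
  by rewrite -sqrrN opprB [leRHS]addrC; apply: th => //; exact: ltW.
have fmq : (y `^ q <= x `^ q)%R by apply: ge0_ler_powR; rewrite ?nnegrE ?(ltW q0).
rewrite !pw [Num.max (x - y)%R 0%R]max_l ?subr_ge0// ler_wpDr ?sqr_ge0//.
rewrite lerXn2r// ?nnegrE ?powR_ge0 ?subr_ge0//.
exact: powR_subadd.
Qed.

Lemma measurable_fun_powR d (T : measurableType d) (R : realType) (g : T -> R)
    (r : R) : measurable_fun [set: T] g ->
  measurable_fun [set: T] (fun x => g x `^ r)%R.
Proof. by move=> mg; exact: (measurableT_comp (measurable_powR r) mg). Qed.

Lemma measurable_pospart_powR d (T : measurableType d) (R : realType) (g : T -> R)
    (r : R) : measurable_fun [set: T] g ->
  measurable_fun [set: T] (fun x => (Num.max (g x) 0 `^ r)%:E).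
Proof.
move=> mg; apply/measurable_EFinP/measurable_fun_powR.
exact: measurable_maxr.
Qed.

(** The variance of [X^q] is at most its second moment about [m^q], which splits into the parts
    above and below [m]. *)
Lemma variance_powR_le d (T : measurableType d) (R : realType)
    (P : probability T R) (X : T -> R) (q m c : R) :
  (0 < q)%R -> (q < 1)%R -> measurable_fun [set: T] X ->
  (forall x, 0 <= X x)%R -> (0 <= m)%R ->
  \int[P]_x (Num.max (X x - m) 0 `^ (2 * q))%:E <= c%:E ->
  \int[P]_x (Num.max (m - X x) 0 `^ (2 * q))%:E <= c%:E ->
  'V_P[(fun x => X x `^ q)%R] <= (c + c)%:E.
Proof.
move=> q0 q1 mX X0 m0 posP negP.
have le : \int[P]_x ((X x `^ q - m `^ q) ^+ 2)%:E <= (c + c)%:E.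
  apply: (@le_trans _ _ (\int[P]_x ((Num.max (X x - m) 0 `^ (2 * q))%:E +
      (Num.max (m - X x) 0 `^ (2 * q))%:E))).
    apply: ge0_integral_le => x _; first by rewrite lee_fin sqr_ge0.
    by rewrite -EFinD lee_fin sqr_powR_sub_le.
  rewrite ge0_integralD//; last 4 first.
  - by move=> x _; rewrite lee_fin powR_ge0.
  - by apply/measurable_pospart_powR/measurable_funB.
  - by move=> x _; rewrite lee_fin powR_ge0.
  - by apply/measurable_pospart_powR/measurable_funB.
  exact: (leeD posP negP).
have fin : \int[P]_x ((X x `^ q - m `^ q) ^+ 2)%:E < +oo.
  exact: le_lt_trans le (ltry _).
exact: le_trans (variance_le_integral (measurable_fun_powR q mX) fin) le.
Qed.

Lemma weak_poincare_Lq (R : realType) (n : nat) (M : riemannianManifold R n)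
    (mu : probability (borel M) R) (nu : {measure set (borel M) -> \bar R})
    (q : R) (beta : R -> R) : (0 < q < 1)%R -> weak_poincare mu nu beta ->
  \int[lebesgue_measure]_(t in `]0%R, (2^-1)%R])
    (beta (t / 4) `^ (q / (1 - q)))%:E < +oo ->
  Lq_poincare mu nu q.
Proof.
move=> /andP[q0 q1] wp Ioo; have [b0 bn _] := wp.
have oq0 : (0 < 1 - q)%R by rewrite subr_gt0.
have [J [J0 _ J_incr]] := profile_primitive b0 bn (ltW (divr_gt0 q0 oq0)) Ioo.
(* The factor 2 counts the two sides of the median. Strict positivity makes the right side [+oo]
   when the energy is infinite. *)
pose K := (2 * (256 `^ q * (1 + (J 2^-1 - J 0))))%R.
have K0 : (0 < K)%R.
  have : (J 0 <= J 2^-1)%R by apply: (J_homo J_incr); rewrite ?invr_ge0.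
  move=> J12; apply: mulr_gt0; first exact: ltr0Sn.
  apply: mulr_gt0; first exact: (powR_gt0 _ (ltr0Sn R 255)).
  by rewrite ltr_pwDl// subr_ge0.
have C0 : (0 < K `^ q^-1)%R by rewrite powR_gt0.
exists (K `^ q^-1)%R; first exact: ltW.
move=> f f1 f0.
have [Ey|Ey] := eqVneq (energy nu f) +oo.
  by rewrite Ey gt0_muley ?leey// lte_fin.
have Ef : energy nu f \is a fin_num by rewrite ge0_fin_numE ?energy_ge0// ltey.
have mf := C1_measurable f1.
have [m [m0 mgt mlt]] := exists_median mu mf f0.
(* Covers [f - m] and [m - f], which have the energy of [f] and are positive on at most half of the
   mass. *)
have shift (s : R) (c : R) : C1 (fun x => s * f x + c)%R /\
    (s ^+ 2 = 1 -> energy nu (fun x => s * f x + c) = energy nu f)%R.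
  have dphi (r : R) : is_derive r 1%R (fun t : R => s * t + c)%R s.
    apply: (@is_derive_quadratic _ _ _ _ 1%R) => // k.
    have -> : (s * (r + k) + c - (s * r + c) - s * k = 0)%R by ring.
    by rewrite normr0 mul1r sqr_ge0.
  have cs : continuous (fun _ : R => s) by move=> x; exact: cst_continuous.
  have [g1 gE] := C1_comp dphi cs f1.
  split=> [|s1]; first exact: g1.
  rewrite /energy; apply: eq_integral => x _; congr EFin.
  by rewrite -[RHS]mul1r -s1; exact: gE.
have key (e : R) : (0 < e)%R -> energy nu f <= e%:E ->
    'V_mu[(fun x => f x `^ q)%R] <= (K * e `^ q)%:E.
  move=> e0 fe.
  set c := (256 `^ q * e `^ q * (1 + (J 2^-1 - J 0)))%R.
  have -> : (K * e `^ q = c + c)%R by rewrite /K /c; ring.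
  have [p1 pE] := shift 1%R (- m)%R; have [n1 nE] := shift (- 1)%R m.
  apply: (variance_powR_le q0 q1 mf f0 m0).
  - have -> : (fun x => (Num.max (f x - m) 0 `^ (2 * q))%:E) =
        (fun x => (Num.max (1 * f x - m) 0 `^ (2 * q))%:E).
      by apply/funext => x; rewrite mul1r.
    apply: (positive_part_integral_le wp q0 q1 J_incr p1 _ e0).
      rewrite (_ : [set x | _] = [set x | (m < f x)%R]); first exact: mgt.
      by apply/funext => x /=; rewrite mul1r subr_gt0.
    by rewrite pE; [exact: fe|exact: expr1n].
  - have -> : (fun x => (Num.max (m - f x) 0 `^ (2 * q))%:E) =
        (fun x => (Num.max (- 1 * f x + m) 0 `^ (2 * q))%:E).
      by apply/funext => x; rewrite mulN1r addrC.
    apply: (positive_part_integral_le wp q0 q1 J_incr n1 _ e0).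
      rewrite (_ : [set x | _] = [set x | (f x < m)%R]); first exact: mlt.
      by apply/funext => x /=; rewrite mulN1r addrC subr_gt0.
    by rewrite nE; [exact: fe|rewrite sqrrN; exact: expr1n].
have V0 : 0 <= 'V_mu[(fun x => f x `^ q)%R] by exact: variance_ge0.
apply/lee_addgt0Pr => eps eps0.
have [E EE] : exists E, energy nu f = E%:E by exists (fine (energy nu f)); rewrite fineK.
have E0 : (0 <= E)%R by rewrite -lee_fin -EE energy_ge0.
(* The level estimates want [e > 0], while the energy may be 0; this increment costs exactly [eps]
   after multiplication by [K^(1/q)]. *)
pose e := (E + eps / K `^ q^-1)%R.
have e0 : (0 < e)%R by rewrite ltr_wpDl// divr_gt0.
have Ee : energy nu f <= e%:E by rewrite EE lee_fin lerDl divr_ge0 ?ltW.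
have qi : (0 <= q^-1)%R by rewrite invr_ge0 ltW.
apply: (le_trans (gt0_ler_poweR qi _ _ (key e e0 Ee))).
- by rewrite in_itv/= V0 leey.
- by rewrite in_itv/= leey lee_fin mulr_ge0 ?powR_ge0// ltW.
rewrite poweR_EFin EE -EFinM -EFinD lee_fin powRM ?powR_ge0 ?(ltW K0)//.
rewrite -[((e `^ q) `^ _)%R]powRrM mulfV ?gt_eqF// powRr1 ?(ltW e0)// /e mulrDr lerD2l.
by rewrite mulrCA mulfV ?gt_eqF// mulr1.
Qed.

Theorem corollary3p4 (R : realType) (n : nat) (M : riemannianManifold R n)
    (mu : probability (borel M) R) (nu : {measure set (borel M) -> \bar R})
    (q : R) (beta_WP : R -> R) :
  (2^-1 <= q < 1)%R ->
  weak_poincare mu nu beta_WP ->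
  \int[lebesgue_measure]_(t in `]0%R, (2^-1)%R])
    (beta_WP (t / 4) `^ (q / (1 - q)))%:E < +oo ->
  Lq_poincare mu nu q /\
  beta_P mu nu q <=
    (kappa_P q)%:E * ((4 / (1 - q)) `^ ((1 - q) / q))%:E *
    (\int[lebesgue_measure]_(t in `]0%R, (2^-1)%R])
       (beta_WP (t / 4) `^ (q / (1 - q)))%:E) `^ ((1 - q) / q).
Proof.
move=> q12 wp Ioo; split; last exact: beta_P_le.
apply: weak_poincare_Lq wp Ioo; have /andP[q2 ->] := q12.
by rewrite (lt_le_trans _ q2)// invr_gt0.
Qed.
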